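(* Let $M\geq 2$ be a prime and let $q$ be a prime power with $(M,q)=1$. Let $t$ be the order of $q$ in $(\mathbb Z/M\mathbb Z)^{\times}$. Then, as formal power series in $u$, $$1+\sum_{n=1}^{\infty}c(n,q,M)\,u^n=\prod_{j=1}^{\infty}\left[c(q,u^j)\,c(q^t,u^{tj})^{\frac{1-M}{Mt}}\prod_{k=1}^{\infty}c(q^t,u^{M^ktj})^{\frac{(1-M)^2}{M^{k+1}t}}\right].$$
   Context: $c(q,u)=\dfrac{1-u}{1-qu}$, viewed as a formal power series in $u$ with constant term $1$; $c(q^t,u^{m})$ is obtained by substituting $q^t$ for $q$ and $u^m$ for $u$. Rational powers of a power series with constant term $1$ are taken by the binomial series (so they again have constant term $1$). $\mathrm{GL}(n,q)$ is the group of invertible $n\times n$ matrices over the field with $q$ elements. $c(n,q,M)$ is the number of conjugacy classes of $\mathrm{GL}(n,q)$ contained in the image of the power map $x\mapsto x^M$ on $\mathrm{GL}(n,q)$. *)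

(* Defs.v *)
From HB Require Import structures.
From mathcomp Require Import all_boot all_order all_fingroup all_algebra.
From mathcomp Require Import boolp classical_sets.

Set Implicit Arguments.
Unset Strict Implicit.
Unset Printing Implicit Defensive.

Import GRing.Theory.
Local Open Scope ring_scope.

(* Formal power series in u with rational coefficients.  The record wrapper
   keeps the Cauchy product apart from the pointwise product of functions. *)
Record fps := FPS { coefs :> nat -> rat }.

Lemma fpsP (f g : fps) : (forall n, f n = g n) -> f = g.
Proof. by case: f g => [f] [g] /= /funext ->. Qed.

HB.instance Definition _ := gen_eqMixin fps.
HB.instance Definition _ := gen_choiceMixin fps.

Definition fps_zero := FPS (fun=> 0).
Definition fps_opp (f : fps) := FPS (fun n => - f n).
Definition fps_add (f g : fps) := FPS (fun n => f n + g n).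

Fact fps_addA : associative fps_add.
Proof. by move=> f g h; apply: fpsP => n /=; rewrite addrA. Qed.
Fact fps_addC : commutative fps_add.
Proof. by move=> f g; apply: fpsP => n /=; rewrite addrC. Qed.
Fact fps_add0 : left_id fps_zero fps_add.
Proof. by move=> f; apply: fpsP => n /=; rewrite add0r. Qed.
Fact fps_addN : left_inverse fps_zero fps_opp fps_add.
Proof. by move=> f; apply: fpsP => n /=; rewrite addNr. Qed.

HB.instance Definition _ :=
  GRing.isZmodule.Build fps fps_addA fps_addC fps_add0 fps_addN.

Definition fpsC (a : rat) := FPS (fun n => if n == 0%N then a else 0).
Definition fpsX := FPS (fun n => (n == 1%N)%:R).
Definition fps_mul (f g : fps) :=
  FPS (fun n => \sum_(i < n.+1) f i * g (n - i)%N).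

Definition fps_trunc N (f : fps) : {poly rat} := \poly_(i < N.+1) f i.

Lemma coef_trunc N f i : (i <= N)%N -> (fps_trunc N f)`_i = f i.
Proof. by move=> le_iN; rewrite coef_poly ltnS le_iN. Qed.

Lemma fps_mulE N f g n :
  (n <= N)%N -> fps_mul f g n = (fps_trunc N f * fps_trunc N g)`_n.
Proof.
move=> le_nN; rewrite coefM; apply: eq_bigr => i _ /=.
by rewrite !coef_trunc // ?(leq_trans (leq_subr _ _)) // (leq_trans (leq_ord i)).
Qed.

Fact fps_mulC : commutative fps_mul.
Proof. by move=> f g; apply: fpsP => n; rewrite !(@fps_mulE n) // mulrC. Qed.

Fact fps_mulA : associative fps_mul.
Proof.
move=> f g h; apply: fpsP => n.
transitivity ((fps_trunc n f * (fps_trunc n g * fps_trunc n h))`_n).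
  rewrite coefM; apply: eq_bigr => i _.
  by rewrite coef_trunc ?leq_ord // -fps_mulE ?leq_subr.
rewrite mulrA coefM; apply: eq_bigr => i _.
by rewrite -fps_mulE ?leq_ord // coef_trunc ?leq_subr.
Qed.

Fact fps_mul1 : left_id (fpsC 1) fps_mul.
Proof.
move=> f; apply: fpsP => n /=; rewrite big_ord_recl /= mul1r subn0.
by rewrite big1 ?addr0 // => i _; rewrite mul0r.
Qed.

Fact fps_mulDl : left_distributive fps_mul fps_add.
Proof.
move=> f g h; apply: fpsP => n /=; rewrite -big_split.
by apply: eq_bigr => i _; rewrite mulrDl.
Qed.

Fact fps_one_neq0 : fpsC 1 != 0.
Proof. by apply/eqP => /(congr1 (fun f : fps => f 0%N)). Qed.

HB.instance Definition _ := GRing.Zmodule_isComNzRing.Build fps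
  fps_mulA fps_mulC fps_mul1 fps_mulDl fps_one_neq0.

Lemma fpsM0 (f g : fps) : (f * g) 0%N = f 0%N * g 0%N.
Proof. by rewrite /= big_ord1. Qed.

Lemma fpsC_mul a (f : fps) n : (fpsC a * f) n = a * f n.
Proof.
rewrite /= big_ord_recl /= subn0 big1 ?addr0 // => i _.
by rewrite mul0r.
Qed.

Lemma fps_sum (I : Type) (r : seq I) (P : pred I) (F : I -> fps) n :
  (\sum_(i <- r | P i) F i) n = \sum_(i <- r | P i) F i n.
Proof. exact: (big_morph (fun f : fps => f n)). Qed.

Lemma fpsX_coef_lt (f : fps) k n : f 0%N = 0 -> (n < k)%N -> (f ^+ k) n = 0.
Proof.
move=> f0; elim: k n => // k IHk n; rewrite ltnS => le_nk.
rewrite exprS /= big_ord_recl /= f0 mul0r add0r big1 // => i _.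
rewrite [X in _ * X]IHk ?mulr0 //= /bump /= add1n.
by rewrite (leq_trans _ le_nk) // ltn_subrL (leq_ltn_trans _ (ltn_ord i)).
Qed.

(* The Neumann series for the inverse; the terms of index k > n do not
   contribute to the coefficient of u^n. *)
Definition fps_inv (f : fps) : fps :=
  if f 0%N == 0 then f else
  FPS (fun n => (f 0%N)^-1 *
    \sum_(k < n.+1) ((1 - fpsC (f 0%N)^-1 * f) ^+ k) n).

Fact fps_mulVx :
  {in [pred f : fps | f 0%N != 0], left_inverse 1 fps_inv *%R}.
Proof.
move=> f; rewrite inE => f0; rewrite /fps_inv (negPf f0).
set g := 1 - _; have g0 : g 0%N = 0.
  by rewrite [LHS]/= big_ord1 /= mulVf // subrr.
have gE : fpsC (f 0%N)^-1 * f = 1 - g by rewrite /g opprB addrC subrK.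
apply: fpsP => n.
pose h : fps := fpsC (f 0%N)^-1 * \sum_(k < n.+1) g ^+ k.
transitivity ((h * f) n).
  apply: eq_bigr => i _; congr (_ * _); rewrite /h fpsC_mul fps_sum /=.
  congr (_ * _).
  rewrite (big_ord_widen n.+1 (fun k => (g ^+ k) i)) ?ltnS ?leq_ord //.
  rewrite big_mkcond /=; apply: eq_bigr => k _; case: ltnP => // lt_ik.
  by rewrite fpsX_coef_lt.
rewrite /h mulrAC gE -[1 - g]opprB mulNr -subrX1 opprB.
by rewrite -[LHS]/((1 : fps) n - (g ^+ n.+1) n) fpsX_coef_lt // subr0.
Qed.

Fact fps_unitPl (f g : fps) : g * f = 1 -> f 0%N != 0.
Proof.
move=> /(congr1 (fun f : fps => f 0%N)) /=; rewrite big_ord1 /= => gf1.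
by apply/eqP => f0; move: gf1; rewrite f0 mulr0.
Qed.

Fact fps_inv_out : {in [predC [pred f : fps | f 0%N != 0]], fps_inv =1 id}.
Proof. by move=> f; rewrite !inE negbK /fps_inv => ->. Qed.

HB.instance Definition _ := GRing.ComNzRing_hasMulInverse.Build fps
  fps_mulVx fps_unitPl fps_inv_out.

(* f(u^m); only meaningful for m > 0. *)
Definition fps_substX (m : nat) (f : fps) : fps :=
  FPS (fun n => if (m %| n)%N then f (n %/ m)%N else 0).

Definition gbinom (r : rat) (k : nat) : rat :=
  (\prod_(i < k) (r - i%:R)) / k`!%:R.

(* f^r = \sum_k gbinom r k (f - 1)^k, for f with constant term 1; the terms
   of index k > n do not contribute to the coefficient of u^n. *)
Definition fps_rpow (f : fps) (r : rat) : fps :=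
  FPS (fun n => \sum_(k < n.+1) gbinom r k * ((f - 1) ^+ k) n).

(* \prod_(j >= 1) F j = g for the u-adic topology. *)
Definition is_infprod (F : nat -> fps) (g : fps) : Prop :=
  forall n, exists N0, forall N, (N0 <= N)%N ->
    (\prod_(1 <= j < N.+1) F j) n = g n.

Definition infprod_cvg (F : nat -> fps) : Prop := exists g, is_infprod F g.

(* Equal to 0 when the product does not converge. *)
Definition infprod (F : nat -> fps) : fps := xget 0 (is_infprod F).

Lemma is_infprod_unique F g h : is_infprod F g -> is_infprod F h -> g = h.
Proof.
move=> Fg Fh; apply: fpsP => n; have [[N FgN] [N' FhN']] := (Fg n, Fh n).
by rewrite -(FgN (maxn N N')) ?leq_maxl // (FhN' (maxn N N')) ?leq_maxr.
Qed.

Lemma infprodE F g : is_infprod F g -> infprod F = g.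
Proof.
by move=> Fg; apply: (is_infprod_unique _ Fg); rewrite /infprod;
  case: xgetP => // /(_ g).
Qed.

Definition cser (q : rat) : fps := (1 - fpsX) / (1 - fpsC q * fpsX).

(* For n = 0 the library's {'GL_n[F]} is GL_1(F); use only for n > 0. *)
Definition nb_power_classes (F : finFieldType) (n M : nat) : nat :=
  #|[set C in classes 'GL_n[F]%g |
      C \subset [set (x ^+ M)%g | x in 'GL_n[F]%g]]|.

Definition power_classes_series (F : finFieldType) (M : nat) : fps :=
  FPS (fun n => if n == 0%N then 1 else (nb_power_classes F n M)%:R).

(* Main.v *)
Require Import Defs.
From mathcomp Require Import all_boot all_order all_fingroup all_algebra.
From mathcomp Require Import cyclic pgroup abelian separable cyclotomic finfield.
From mathcomp Require Import boolp qpoly qfpoly zify ring.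

Set Implicit Arguments.
Unset Strict Implicit.
Unset Printing Implicit Defensive.

Import GRing.Theory Num.Theory.
Local Open Scope ring_scope.

(** A conjugacy class of GL(n, q) is a module over F[X] of dimension n on which X
is invertible, that is, a direct sum of cyclic modules F[X] / (f^k) with f monic
irreducible and different from X; the multiplicities of the pairs (f, k)
determine the class and can be prescribed at will, subject to the total
dimension being n.

The image of x |-> x^M is visible on these multiplicities.  Call f bad when
its root alpha generates a field F(alpha) in which alpha is not an M-th power;
if f has degree d this means that M divides q^d - 1 and that
alpha^((q^d - 1) / M) != 1.
- If f is not bad, then X is an M-th power modulo f (good_root), hence modulo
  every f^k (root_lift), so that the companion matrix of f^k is an M-th power.
- If f is bad, then f(X^M) is irreducible (bad_irreducible).  For A = B^M the
  matrix f(A)^k is f(X^M)(B)^k, and comparing ranks shows that the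
  multiplicity of (f, k) in A is M times that of (f(X^M), k) in B (mult_mpow).
So a class consists of M-th powers exactly when M divides the multiplicity of
(f, k) for all bad f and all k, and the generating series is the product over f
and k of 1 / (1 - u^(k e d)), where d = deg f, and e = M if f is bad, e = 1
otherwise (nb_power_classes_coef).

Grouping by k, it remains to see that the product over f of 1 / (1 - u^(j e d))
is the j-th outer factor of the theorem (outer_factorE).  Both series have
constant term 1, so it is enough to compare the quotients theta g / g, with
theta = u d/du.  Rational powers, products and substitutions u |-> u^w all have
transparent effects on this quotient, and the comparison becomes an identity
between numbers for each exponent m (dlog_identity).  Its input is the
factorization of X^a - 1 into distinct irreducible factors: for a = q^m - 1 it
says that the degrees of the f of degree dividing m add up to q^m - 1, and
together with a = (q^m - 1) / M it says that the degrees of the bad f with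
d | m and M not dividing m / d add up to (q^m - 1)(M - 1) / M if t | m, and
to 0 otherwise.  Summing the latter over m, m / M, m / M^2, ... accounts for
all bad f (sum_deg_bad_rec); this is where the inner product over k comes
from. *)

(** * Logarithmic derivatives of power series *)

Section Fps.
Implicit Types (f g h : fps).

Lemma coef_fpsM f g n : (f * g) n = \sum_(i < n.+1) f i * g (n - i)%N.
Proof. by []. Qed.

Lemma coef_fpsD f g n : (f + g) n = f n + g n. Proof. by []. Qed.
Lemma coef_fpsB f g n : (f - g) n = f n - g n. Proof. by []. Qed.
Lemma coef_fps1 n : (1 : fps) n = (n == 0%N)%:R.
Proof. by case: n. Qed.

Lemma fps_lreg f : f 0%N = 1 -> injective ( *%R f).
Proof.
move=> f0; have Vf : fps_inv f * f = 1 by apply: fps_mulVx; rewrite inE f0 oner_neq0.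
by move=> g h /(congr1 ( *%R (fps_inv f))); rewrite !mulrA Vf !mul1r.
Qed.

(** Congruence modulo u^(N+1).  Infinite products are only ever handled through
it, since modulo a power of u they are finite products. *)
Definition eqm N f g := forall i, (i <= N)%N -> f i = g i.

Lemma eqm_refl N f : eqm N f f. Proof. by []. Qed.
Lemma eqm_sym N f g : eqm N f g -> eqm N g f.
Proof. by move=> fg i /fg. Qed.
Lemma eqm_trans N f g h : eqm N f g -> eqm N g h -> eqm N f h.
Proof. by move=> fg gh i le_i; rewrite fg ?gh. Qed.

Lemma eqmW N N' f g : (N' <= N)%N -> eqm N f g -> eqm N' f g.
Proof. by move=> le_N fg i le_i; rewrite fg // (leq_trans le_i). Qed.

Lemma eqmM N f f' g g' : eqm N f f' -> eqm N g g' -> eqm N (f * g) (f' * g').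
Proof.
move=> Ef Eg i le_i; rewrite !coef_fpsM; apply: eq_bigr => j _.
by rewrite Ef ?Eg // (leq_trans _ le_i) ?leq_subr // -ltnS.
Qed.

Lemma eqm_prod N (I : Type) (r : seq I) (P : pred I) (F G : I -> fps) :
  (forall i, P i -> eqm N (F i) (G i)) ->
  eqm N (\prod_(i <- r | P i) F i) (\prod_(i <- r | P i) G i).
Proof. by move=> FG; elim/big_rec2: _ => // i f g Pi; apply/eqmM/FG. Qed.

(** The derivation u d/du. *)
Definition theta f : fps := FPS (fun n => n%:R * f n).

Lemma thetaM f g : theta (f * g) = theta f * g + f * theta g.
Proof.
apply: fpsP => n; rewrite coef_fpsD !coef_fpsM /= mulr_sumr -big_split /=.
apply: eq_bigr => i _.
have -> : n%:R = i%:R + (n - i)%:R :> rat by rewrite -natrD subnKC // -ltnS.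
ring.
Qed.

Lemma theta1 : theta 1 = 0.
Proof. by apply: fpsP => -[|n] /=; rewrite ?mul0r ?mulr0. Qed.

Lemma thetaB f g : theta (f - g) = theta f - theta g.
Proof. by apply: fpsP => n /=; rewrite mulrBr. Qed.

(** The relation l = theta f / f, stated without division. *)
Definition is_dlog f l := theta f = l * f.

Lemma is_dlog1 : is_dlog 1 0.
Proof. by rewrite /is_dlog theta1 mul0r. Qed.

Lemma is_dlogM f g l m : is_dlog f l -> is_dlog g m -> is_dlog (f * g) (l + m).
Proof. by rewrite /is_dlog thetaM => -> ->; ring. Qed.

Lemma is_dlog_prod (I : Type) (r : seq I) (P : pred I) (F L : I -> fps) :
  (forall i, P i -> is_dlog (F i) (L i)) ->
  is_dlog (\prod_(i <- r | P i) F i) (\sum_(i <- r | P i) L i).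
Proof.
move=> FL; elim/big_rec2: _ => [|i f l Pi]; first exact: is_dlog1.
exact/is_dlogM/FL.
Qed.

Lemma is_dlogMr f g l m : g 0%N = 1 -> is_dlog (f * g) l -> is_dlog g m ->
  is_dlog f (l - m).
Proof.
move=> g0; rewrite /is_dlog thetaM => fgl gm; apply: (fps_lreg g0).
by rewrite mulrC -(addrK (f * theta g) (_ * g)) fgl gm; ring.
Qed.

(** The coefficient equation n f_n = sum_(i > 0) l_i f_(n - i) determines f from
l and its constant term; it is triangular, hence the version modulo u^(N+1). *)
Lemma dlog_eqm N f g l m : f 0%N = 1 -> g 0%N = 1 -> is_dlog f l -> is_dlog g m ->
  eqm N l m -> eqm N f g.
Proof.
move=> f0 g0 fl gm lm n; elim/ltn_ind: n => n IHn le_nN.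
have dlog0 h k : h 0%N = 1 -> is_dlog h k -> k 0%N = 0.
  by move=> h0 /(congr1 (fun f : fps => f 0%N)); rewrite fpsM0 h0 /= mul0r mulr1.
case: n => [|n] in IHn le_nN *; first by rewrite f0.
have dlogS h k : h 0%N = 1 -> is_dlog h k ->
    n.+1%:R * h n.+1 = \sum_(i < n.+1) k i.+1 * h (n - i)%N.
  move=> h0 hk; have /(congr1 (fun f : fps => f n.+1)) := hk.
  by rewrite coef_fpsM big_ord_recl (dlog0 h) // mul0r add0r.
apply: (@mulfI _ n.+1%:R); first by rewrite pnatr_eq0.
rewrite (dlogS f l) // (dlogS g m) //; apply: eq_bigr => i _.
rewrite lm ?IHn //; last by rewrite (leq_trans (ltn_ord i)).
  by rewrite ltnS leq_subr.
by rewrite (leq_trans (leq_subr _ _)) // ltnW.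
Qed.

(** Truncated to polynomials, this substitution is composition with X^w, which is
multiplicative. *)
Lemma substXM w f g : (0 < w)%N ->
  fps_substX w (f * g) = fps_substX w f * fps_substX w g.
Proof.
move=> w_gt0; have E h n i : (i <= n)%N ->
    fps_substX w h i = (fps_trunc n h \Po 'X^w)`_i.
  move=> le_in; rewrite coef_comp_poly_Xn //=; case: ifP => // w_i.
  by rewrite coef_trunc // (leq_trans (leq_div _ _)).
apply: fpsP => n; rewrite coef_fpsM.
transitivity ((fps_trunc n f * fps_trunc n g \Po 'X^w)`_n).
  rewrite coef_comp_poly_Xn //=; case: ifP => // w_n.
  by rewrite -fps_mulE ?leq_div.
rewrite comp_polyM coefM; apply: eq_bigr => i _.
by rewrite !(E _ n) ?leq_subr // -ltnS.
Qed.

Lemma theta_substX w f : theta (fps_substX w f) = fpsC w%:R * fps_substX w (theta f).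
Proof.
apply: fpsP => n; rewrite fpsC_mul /=; case: ifP => [w_n|_]; last by rewrite !mulr0.
by rewrite mulrA -natrM mulnC divnK.
Qed.

Lemma is_dlog_substX w f l : (0 < w)%N -> is_dlog f l ->
  is_dlog (fps_substX w f) (fpsC w%:R * fps_substX w l).
Proof. by move=> w0; rewrite /is_dlog theta_substX => ->; rewrite substXM // mulrA. Qed.

Lemma substX0 w f : fps_substX w f 0%N = f 0%N.
Proof. by rewrite /= dvdn0 div0n. Qed.

Lemma rpow0 f r : fps_rpow f r 0%N = 1.
Proof.
transitivity (gbinom r 0 * ((f - 1) ^+ 0) 0%N); first exact: big_ord1.
by rewrite /gbinom big_ord0 expr0 fact0 divr1 mulr1.
Qed.

Lemma gbinomS r k : k.+1%:R * gbinom r k.+1 = (r - k%:R) * gbinom r k.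
Proof.
rewrite /gbinom big_ord_recr /= factS natrM.
have f0 : (k`!)%:R != 0 :> rat by rewrite pnatr_eq0 -lt0n fact_gt0.
have k0 : k.+1%:R != 0 :> rat by rewrite pnatr_eq0.
move: (k.+1%:R : rat) (k`!%:R : rat) (k%:R : rat) k0 f0 => a b c a0 b0.
by field; rewrite a0 b0.
Qed.

Lemma fpsC_nat k : fpsC k%:R = k%:R.
Proof.
elim: k => [|k IHk]; first by apply: fpsP => -[|n].
by rewrite -!natr1 -IHk; apply: fpsP => -[|n] /=; rewrite ?addr0.
Qed.

Lemma fpsCB a b : fpsC (a - b) = fpsC a - fpsC b.
Proof. by apply: fpsP => -[|n] /=; rewrite ?subr0. Qed.

Lemma fpsCM a b : fpsC (a * b) = fpsC a * fpsC b.
Proof. by apply: fpsP => n; rewrite fpsC_mul /=; case: n => [|n] /=; rewrite ?mulr0. Qed.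

Lemma thetaX g k : theta (g ^+ k.+1) = k.+1%:R * g ^+ k * theta g.
Proof.
elim: k => [|k IHk]; first by rewrite expr1 expr0 !mul1r.
by rewrite exprS thetaM IHk -[k.+2%:R]natr1 [g ^+ k.+1]exprS; ring.
Qed.

Lemma thetaD f g : theta (f + g) = theta f + theta g.
Proof. by apply: fpsP => n /=; rewrite mulrDr. Qed.

(** The telescoping form of (1 + g) theta ((1 + g)^r) = r theta g (1 + g)^r: the
recurrence (k + 1) binom(r, k + 1) = (r - k) binom(r, k) cancels all terms but
the last one, which is divisible by u^(n+1) when g has no constant term. *)
Lemma theta_binom_sum g r n :
  let S := \sum_(k < n.+1) fpsC (gbinom r k) * g ^+ k in
  (1 + g) * theta S =
  theta g * (fpsC r * S) - fpsC (gbinom r n.+1) * theta (g ^+ n.+1).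
Proof.
have thetaC a h : theta (fpsC a * h) = fpsC a * theta h.
  apply: fpsP => i; rewrite fpsC_mul -[LHS]/(i%:R * (fpsC a * h) i) fpsC_mul.
  by rewrite mulrCA.
have bS k : k.+1%:R * fpsC (gbinom r k.+1) = (fpsC r - k%:R) * fpsC (gbinom r k).
  by rewrite -!fpsC_nat -fpsCB -!fpsCM gbinomS.
elim: n => [|n IHn] /=.
  rewrite big_ord1 thetaC expr0 theta1 expr1.
  have := bS 0%N; rewrite mul1r => ->; ring.
rewrite big_ord_recr /= thetaD thetaC mulrDr IHn [theta (g ^+ n.+2)]thetaX.
rewrite [X in _ = _ - X](_ : _ =
  (n.+2%:R * fpsC (gbinom r n.+2)) * g ^+ n.+1 * theta g); last by ring.
rewrite bS thetaX exprS -natr1; ring.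
Qed.

Lemma is_dlog_rpow f l r : f 0%N = 1 -> is_dlog f l ->
  is_dlog (fps_rpow f r) (fpsC r * l).
Proof.
move=> f0 fl; apply: (fps_lreg f0); set g := f - 1.
have g0 : g 0%N = 0 by rewrite coef_fpsB f0 subrr.
apply: fpsP => n.
(* Up to degree n the binomial series is the finite sum S. *)
pose S := \sum_(k < n.+1) fpsC (gbinom r k) * g ^+ k.
have rS : eqm n (fps_rpow f r) S.
  move=> i le_in; rewrite fps_sum -[LHS]/(\sum_(k < i.+1) gbinom r k * (g ^+ k) i).
  rewrite (big_ord_widen n.+1 (fun k => gbinom r k * (g ^+ k) i)) ?ltnS //.
  rewrite big_mkcond; apply: eq_bigr => k _; rewrite fpsC_mul.
  by case: ltnP => // lt_ik; rewrite fpsX_coef_lt // mulr0.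
have theta_rS : eqm n (theta (fps_rpow f r)) (theta S).
  by move=> i le_in; rewrite -[LHS]/(i%:R * fps_rpow f r i) rS.
rewrite (eqmM (@eqm_refl n f) theta_rS) //.
rewrite (eqmM (@eqm_refl n f) (eqmM (@eqm_refl n (fpsC r * l)) rS)) //.
have fE : f = 1 + g by rewrite addrC subrK.
have theta_g : theta g = l * f by rewrite thetaB theta1 subr0.
have gn0 : theta (g ^+ n.+1) n = 0.
  by rewrite -[LHS]/(n%:R * (g ^+ n.+1) n) fpsX_coef_lt // mulr0.
rewrite {1}fE theta_binom_sum -/S theta_g coef_fpsB fpsC_mul gn0 mulr0 subr0.
by congr (coefs _ n); ring.
Qed.

End Fps.

(** * The series of the statement and infinite products *)

Section Products.
Implicit Types (f g h : fps) (F : nat -> fps).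

Lemma coef_fpsXM f n : (fpsX * f) n = if n is m.+1 then f m else 0.
Proof.
rewrite coef_fpsM big_ord_recl /= mul0r add0r.
case: n => [|n]; first by rewrite big_ord0.
rewrite big_ord_recl big1 /= ?addr0 ?mul1r ?subSS ?subn0 // => i _.
by rewrite mul0r.
Qed.

Lemma coef_fpsXn a n : (fpsX ^+ a) n = (n == a)%:R.
Proof.
elim: a n => [|a IHa] n; first by rewrite expr0 coef_fps1.
by rewrite exprS coef_fpsXM; case: n.
Qed.

Definition geo_series (a : rat) := FPS (fun n => a ^+ n).

Lemma geo_seriesV a : (1 - fpsC a * fpsX) * geo_series a = 1.
Proof.
rewrite mulrBl mul1r -mulrA; apply: fpsP => -[|n];
  rewrite coef_fpsB fpsC_mul coef_fpsXM coef_fps1 /=.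
  by rewrite expr0 mulr0 subr0.
by rewrite exprS subrr.
Qed.

Lemma is_dlog_geo_series a : is_dlog (geo_series a) (geo_series a - 1).
Proof.
apply: fpsP => n; rewrite mulrBl mul1r coef_fpsB coef_fpsM.
rewrite (eq_bigr (fun=> a ^+ n)); last first.
  by move=> i _; rewrite /= -exprD subnKC // -ltnS.
by rewrite sumr_const card_ord /= mulrS addrAC subrr add0r mulr_natl.
Qed.

(** A form of c(a, u) = (1 - u) / (1 - a u) in which the quotient is by a series
whose logarithmic derivative is known. *)
Lemma cserE a : cser a * geo_series 1 = geo_series a.
Proof.
have := geo_seriesV 1; have -> : fpsC 1 = 1 by [].
rewrite mul1r => geo1; rewrite /cser (mulr1_eq (geo_seriesV a)).
by rewrite mulrAC geo1 mul1r.
Qed.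

Lemma cser0 a : cser a 0%N = 1.
Proof.
by have /(congr1 (fun f : fps => f 0%N)) := cserE a; rewrite fpsM0 /= !expr0 mulr1.
Qed.

Lemma is_dlog_cser a : is_dlog (cser a) (geo_series a - geo_series 1).
Proof.
have -> : geo_series a - geo_series 1 = (geo_series a - 1) - (geo_series 1 - 1) by ring.
apply: (@is_dlogMr _ (geo_series 1)); [by rewrite /= expr0 | | exact: is_dlog_geo_series].
by rewrite cserE; apply: is_dlog_geo_series.
Qed.

Lemma eqm_rpow w f r : eqm w f 1 -> eqm w (fps_rpow f r) 1.
Proof.
move=> f1 i le_iw; rewrite -[LHS]/(\sum_(k < i.+1) gbinom r k * ((f - 1) ^+ k) i).
rewrite big_ord_recl big1 => [|k _].
  by rewrite addr0 /gbinom big_ord0 expr0 fact0 divr1 mul1r.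
have fk : eqm w ((f - 1) ^+ k.+1) 0.
  rewrite exprS -(mul0r ((f - 1) ^+ k)); apply: eqmM => // j le_j.
  by rewrite coef_fpsB f1 // subrr.
by rewrite fk ?mulr0.
Qed.

Lemma eqm_substX w f : f 0%N = 1 -> eqm w.-1 (fps_substX w f) 1.
Proof.
move=> f0 [|i] lt_iw; first by rewrite substX0.
rewrite coef_fps1 /= gtnNdvd //; case: w lt_iw => // w.
Qed.

(** The hypothesis is the convergence criterion used throughout: the j-th factor
is 1 + O(u^j), so the factors beyond n do not affect the coefficient of u^n. *)
Lemma prod_tail F n N : (forall j, (0 < j)%N -> eqm j.-1 (F j) 1) -> (n <= N)%N ->
  eqm n (\prod_(1 <= j < N.+1) F j) (\prod_(1 <= j < n.+1) F j).
Proof.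
move=> F1 le_nN; rewrite (@big_cat_nat _ _ _ n.+1) //=.
rewrite -[X in eqm _ _ X]mulr1; apply: eqmM => //.
rewrite big_nat_cond.
have : eqm n (\prod_(n.+1 <= i < N.+1 | (n < i < N.+1)%N && true) F i)
             (\prod_(n.+1 <= i < N.+1 | (n < i < N.+1)%N && true) 1).
  apply: eqm_prod => i /andP[/andP[lt_ni _] _].
  by apply: (@eqmW i.-1); [rewrite -ltnS (ltn_predK lt_ni) | apply: F1; case: i lt_ni].
by rewrite big1_eq.
Qed.

Lemma is_infprod_tail F : (forall j, (0 < j)%N -> eqm j.-1 (F j) 1) ->
  is_infprod F (FPS (fun n => (\prod_(1 <= j < n.+1) F j) n)).
Proof. by move=> F1 n; exists n => N le_nN; rewrite (prod_tail F1 le_nN). Qed.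

Lemma infprod_eqm F N : (forall j, (0 < j)%N -> eqm j.-1 (F j) 1) ->
  eqm N (infprod F) (\prod_(1 <= j < N.+1) F j).
Proof.
move=> F1 i le_iN; rewrite (infprodE (is_infprod_tail F1)).
by rewrite (prod_tail F1 le_iN).
Qed.

(** The series 1 / (1 - u^w). *)
Definition geomX w := fps_substX w (geo_series 1).

Lemma coef_geomX w n : geomX w n = (w %| n)%:R.
Proof. by rewrite /= expr1n; case: ifP. Qed.

(** Expanding each factor as the sum of the u^(a w_i) over the multiples a of e_i
and distributing, the coefficient of u^n counts the multiplicity functions m
supported on P with e_i | m_i and total weight n.  All the m_i are at most n
because the weights are positive. *)
Lemma coef_prod_geomX (I : finType) (P : pred I) (w e : I -> nat) n :
  (forall i, P i -> 0 < w i)%N -> (forall i, 0 < e i)%N ->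
  (\prod_(i | P i) geomX (w i * e i)) n =
  #|[set m : {ffun I -> 'I_n.+1} |
      [forall i, if P i then (e i %| m i)%N else m i == ord0]
      && (\sum_i m i * w i == n)%N]|%:R.
Proof.
move=> w_gt0 e_gt0.
have geomE i : P i -> eqm n (geomX (w i * e i))
    (\sum_(a : 'I_n.+1 | (e i %| a)%N) fpsX ^+ (a * w i)).
  move=> Pi j le_jn; rewrite coef_geomX fps_sum.
  under eq_bigr do rewrite coef_fpsXn.
  have [we_j | nwe_j] := boolP (w i * e i %| j)%N; last first.
    rewrite big1 // => a /dvdnP[b ab]; case: eqP => // jE; case/negP: nwe_j.
    by rewrite jE ab -mulnA [(e i * _)%N]mulnC dvdn_mull.
  have w_j : (w i %| j)%N by apply: dvdn_trans we_j; apply: dvdn_mulr.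
  have lt_a : (j %/ w i < n.+1)%N by rewrite ltnS (leq_trans (leq_div _ _)).
  rewrite (bigD1 (Ordinal lt_a)) /=; last by rewrite dvdn_divRL // mulnC.
  rewrite divnK // eqxx big1 ?addr0 // => a /andP[_ a_ne].
  case: eqP => // jE; case/eqP: a_ne; apply: val_inj => /=.
  by rewrite jE mulnK // w_gt0.
rewrite (eqm_prod _ geomE) // (big_distr_big_dep ord0) fps_sum.
rewrite -sum1_card natr_sum big_mkcond [RHS]big_mkcond; apply: eq_bigr => m _.
rewrite inE; have -> : [forall i, if P i then (e i %| m i)%N else m i == ord0] =
    (m \in pfamily ord0 P (fun i (a : 'I_n.+1) => (e i %| a)%N)).
  apply/forallP/pfamilyP => [mP | [/supportP m0 mP] i]; last first.
    case: ifP => Pi; first exact: mP i Pi.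
    by apply/eqP/m0; rewrite unfold_in Pi.
  split=> [|i Pi]; last by have := mP i; rewrite unfold_in in Pi; rewrite Pi.
  apply/supportP => i nPi; have := mP i; rewrite unfold_in in nPi.
  by rewrite (negPf nPi) => /eqP.
case: ifP => // /pfamilyP[/supportP m0 _].
have -> : (\sum_i m i * w i = \sum_(i | P i) m i * w i)%N.
  by rewrite (bigID P) /= addnC big1 ?add0n // => i nPi; rewrite m0.
by rewrite -expr_sum coef_fpsXn eq_sym; case: eqP.
Qed.

End Products.

(** * Similarity of square matrices *)

Section MatrixEvaluation.
Variable F : fieldType.

(** Polynomial evaluation for square matrices of every size, including the empty
one, so that block decompositions and inductions on the size need no case
distinction. *)
Definition mxev n (A : 'M[F]_n) (p : {poly F}) : 'M[F]_n :=
  (if n is n'.+1 then fun A : 'M_n'.+1 => horner_mx A p else fun=> 0) A.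

Lemma mxevD n (A : 'M[F]_n) p r : mxev A (p + r) = mxev A p + mxev A r.
Proof. by case: n A => [|n] A; [rewrite !flatmx0 | exact: rmorphD]. Qed.

Lemma mxevM n (A : 'M[F]_n) p r : mxev A (p * r) = mxev A p *m mxev A r.
Proof. by case: n A => [|n] A; [rewrite !flatmx0 | exact: rmorphM]. Qed.

Lemma mxevC n (A : 'M[F]_n) a : mxev A a%:P = a%:M.
Proof. by case: n A => [|n] A; [rewrite !flatmx0 | exact: horner_mx_C]. Qed.

Lemma mxev1 n (A : 'M[F]_n) : mxev A 1 = 1%:M.
Proof. exact: mxevC. Qed.

Lemma mxev0 n (A : 'M[F]_n) : mxev A 0 = 0.
Proof. by rewrite mxevC raddf0. Qed.

Lemma mxevX n (A : 'M[F]_n) : mxev A 'X = A.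
Proof. by case: n A => [|n] A; [rewrite !flatmx0 | exact: horner_mx_X]. Qed.

Lemma mxev_exp n (A : 'M[F]_n) p k : mxev A (p ^+ k) = mxev A p ^+ k.
Proof. by elim: k => [|k IHk]; rewrite ?expr0 ?mxev1 // !exprS mxevM IHk. Qed.

Lemma mxev_comp n (A : 'M[F]_n) p r : mxev A (p \Po r) = mxev (mxev A r) p.
Proof.
elim/poly_ind: p => [|p c IHp]; first by rewrite comp_poly0 !mxev0.
by rewrite comp_poly_MXaddC !mxevD !mxevM IHp mxevX !mxevC.
Qed.

Lemma mxev_intertw n m (A : 'M[F]_n) (B : 'M[F]_m) (P : 'M[F]_(n, m)) p :
  A *m P = P *m B -> mxev A p *m P = P *m mxev B p.
Proof.
move=> AP; elim/poly_ind: p => [|p c IHp].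
  by rewrite !mxev0 mul0mx mulmx0.
rewrite !mxevD !mxevM !mxevX !mxevC mulmxDl mulmxDr -!mulmxA AP !mulmxA IHp.
by rewrite scalar_mxC.
Qed.

Lemma mxev_block n m (A : 'M[F]_n) (B : 'M[F]_m) p :
  mxev (block_mx A 0 0 B) p = block_mx (mxev A p) 0 0 (mxev B p).
Proof.
elim/poly_ind: p => [|p c IHp].
  by rewrite !mxev0 -[RHS]/(block_mx 0 0 0 0) block_mx0.
rewrite !mxevD !mxevM IHp !mxevX !mxevC mulmx_block scalar_mx_block add_block_mx.
by rewrite !(mul0mx, mulmx0, addr0, add0r).
Qed.

End MatrixEvaluation.

Section Similarity.
Variable F : fieldType.

(** Similarity is allowed to relate matrices whose sizes are only provably equal
(see [mxsim_size]); this keeps casts out of the theory of block matrices. *)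
Definition mxsim n m (A : 'M[F]_n) (B : 'M[F]_m) :=
  exists (P : 'M[F]_(n, m)) (Q : 'M[F]_(m, n)),
    [/\ P *m Q = 1%:M, Q *m P = 1%:M & A *m P = P *m B].

Lemma mxsim_refl n (A : 'M[F]_n) : mxsim A A.
Proof. by exists 1%:M, 1%:M; rewrite !mulmx1 mul1mx; split. Qed.

Lemma mxsim_sym n m (A : 'M[F]_n) (B : 'M[F]_m) : mxsim A B -> mxsim B A.
Proof.
move=> [P [Q [PQ QP AP]]]; exists Q, P; split=> //.
by rewrite -[LHS]mul1mx -QP -mulmxA (mulmxA P) -AP -!mulmxA PQ mulmx1.
Qed.

Lemma mxsim_trans n m l (A : 'M[F]_n) (B : 'M[F]_m) (C : 'M[F]_l) :
  mxsim A B -> mxsim B C -> mxsim A C.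
Proof.
move=> [P [Q [PQ QP AP]]] [R [S [RS SR BR]]]; exists (P *m R), (S *m Q).
split; last by rewrite mulmxA AP -mulmxA BR mulmxA.
  by rewrite mulmxA -(mulmxA P) RS mulmx1.
by rewrite mulmxA -(mulmxA S) QP mulmx1.
Qed.

Lemma mxsim_intertw n m (A : 'M[F]_n) (B : 'M[F]_m) P :
  row_free P -> row_full P -> A *m P = P *m B -> mxsim A B.
Proof.
by move=> fP uP AP; exists P, (pinvmx P); split; rewrite ?mulmxVp ?mulVpmx.
Qed.

Lemma mxsim_size n m (A : 'M[F]_n) (B : 'M[F]_m) : mxsim A B -> n = m.
Proof.
suff le_nm l k (P : 'M[F]_(l, k)) Q : P *m Q = 1%:M -> (l <= k)%N.
  by move=> [P [Q [/le_nm le1 /le_nm le2 _]]]; apply/eqP; rewrite eqn_leq le1.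
by move=> PQ; rewrite -(mxrank1 F l) -PQ (leq_trans (mxrankM_maxl _ _)) ?rank_leq_col.
Qed.

Lemma mxsim_mxev n m (A : 'M[F]_n) (B : 'M[F]_m) p :
  mxsim A B -> mxsim (mxev A p) (mxev B p).
Proof.
by move=> [P [Q [PQ QP AP]]]; exists P, Q; split=> //; apply: mxev_intertw.
Qed.

Lemma mxsim_rank n m (A : 'M[F]_n) (B : 'M[F]_m) :
  mxsim A B -> \rank A = \rank B.
Proof.
suff le_rk k l (C : 'M[F]_k) (D : 'M[F]_l) :
    mxsim C D -> (\rank C <= \rank D)%N.
  by move=> sAB; apply/eqP; rewrite eqn_leq !le_rk //; apply: mxsim_sym.
move=> [P [Q [PQ QP CP]]]; rewrite -[C]mulmx1 -PQ mulmxA CP -mulmxA.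
by rewrite (leq_trans (mxrankM_maxr _ _)) // mxrankM_maxl.
Qed.

Lemma mxsim_block n m n' m' (A : 'M[F]_n) (A' : 'M[F]_n')
    (B : 'M[F]_m) (B' : 'M[F]_m') :
  mxsim A A' -> mxsim B B' ->
  mxsim (block_mx A 0 0 B) (block_mx A' 0 0 B').
Proof.
move=> [P [Q [PQ QP AP]]] [R [S [RS SR BR]]].
exists (block_mx P 0 0 R), (block_mx Q 0 0 S).
by rewrite !mulmx_block !(mul0mx, mulmx0, addr0, add0r) PQ QP RS SR AP BR
  -!scalar_mx_block.
Qed.

Lemma mxsim_cast n m (e : n = m) (A : 'M[F]_n) : mxsim (castmx (e, e) A) A.
Proof. by case: m / e; rewrite castmx_id; apply: mxsim_refl. Qed.

Lemma mxsim_blockA n m l (A : 'M[F]_n) (B : 'M[F]_m) (C : 'M[F]_l) :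
  mxsim (block_mx A 0 0 (block_mx B 0 0 C)) (block_mx (block_mx A 0 0 B) 0 0 C).
Proof.
have /= E := @block_mxA _ n m l n m l A 0 0 0 B 0 0 0 C.
by rewrite row_mx0 col_mx0 in E; rewrite E row_mx0 col_mx0; apply: mxsim_cast.
Qed.

Lemma mxsim_blockC n m (A : 'M[F]_n) (B : 'M[F]_m) :
  mxsim (block_mx A 0 0 B) (block_mx B 0 0 A).
Proof.
exists (block_mx 0 1%:M 1%:M 0), (block_mx 0 1%:M 1%:M 0).
by rewrite !mulmx_block !(mul0mx, mulmx0, addr0, add0r, mul1mx, mulmx1)
  -!scalar_mx_block.
Qed.

End Similarity.

(** * Companion matrices *)

Section Companion.
Variables (F : fieldType) (f : {poly F}).
Hypotheses (f_monic : f \is monic) (f_gt1 : (1 < size f)%N).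
Let C := companionmx f.
Let f0 : f != 0. Proof. exact: monic_neq0. Qed.

Lemma size_rVpoly_lt (u : 'rV[F]_(size f).-1) : (size (rVpoly u) < size f)%N.
Proof. by rewrite -[X in (_ < X)%N](prednK (ltnW f_gt1)) ltnS size_poly. Qed.

(** On row vectors read as polynomials of degree less than that of f, the
companion matrix is multiplication by X in F[X] / (f). *)
Lemma rVpoly_companion u : rVpoly (u *m C) = (rVpoly u * 'X) %% f.
Proof.
rewrite [u]row_sum_delta mulmx_suml linear_sum [in RHS]linear_sum /= mulr_suml.
rewrite (big_morph (fun p => p %% f) (modpD f) (mod0p f)).
apply: eq_bigr => i _; rewrite -scalemxAl !linearZ /= -scalerAl modpZl.
congr (_ *: _); rewrite rVpoly_delta -exprSr.
have [lt_i | ge_i] := ltnP i.+1 (size f).-1.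
  by rewrite mulmx_delta_companion rVpoly_delta modp_small // size_polyXn -ltn_predRL.
(* The last row: X^d = - sum_j f_j X^j modulo the monic polynomial f. *)
have {ge_i} iE : i.+1 = (size f).-1 by apply/eqP; rewrite eqn_leq ge_i ltn_ord.
apply: (@modpP _ _ 1); last exact: size_rVpoly_lt.
rewrite mul1r; apply/polyP => j; rewrite coefXn coefD coef_rVpoly.
case: insubP => [k _ <- | ]; last first.
  rewrite -leqNgt iE addr0 leq_eqVlt => /orP[/eqP<-|lt_j].
    by rewrite eqxx -lead_coefE (eqP f_monic).
  by rewrite gtn_eqF // nth_default // -(prednK (ltnW f_gt1)).
rewrite mxE (bigD1 i) //= big1 => [|l /negPf ne_li]; last first.
  by rewrite mxE ne_li mul0r.
rewrite !mxE !eqxx mul1r.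
have -> : (i == (size f).-1.-1 :> nat) by apply/eqP; apply: (congr1 predn iE).
by rewrite addr0 subrr ltn_eqF // iE ltn_ord.
Qed.

Lemma rVpoly_mxev_companion u p : rVpoly (u *m mxev C p) = (rVpoly u * p) %% f.
Proof.
elim/poly_ind: p => [|p c IHp] in u *.
  by rewrite mxev0 mulmx0 linear0 mulr0 mod0p.
rewrite mxevD mxevM mxevX mxevC mulmxDr mulmxA linearD /= rVpoly_companion IHp.
rewrite mul_mx_scalar linearZ /= mulrDr modpD mulrC modp_mul mulrC -mulrA.
congr (_ + _); rewrite mulrC mul_polyC modpZl modp_small //.
exact: size_rVpoly_lt.
Qed.

Lemma mxev_companion0 p : f %| p -> mxev C p = 0.
Proof.
move=> f_p; apply/row_matrixP => i; rewrite rowE row0 -[RHS](rVpolyK).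
rewrite linear0 -[LHS]rVpolyK rVpoly_mxev_companion; congr poly_rV.
by apply: modp_eq0; rewrite dvdp_mull.
Qed.

Lemma companion_ker u p : u *m mxev C p = 0 -> f %| rVpoly u * p.
Proof.
by move=> up0; apply/modp_eq0P; rewrite -rVpoly_mxev_companion up0 linear0.
Qed.

Lemma rank_companion_coprime p : coprimep f p -> \rank (mxev C p) = (size f).-1.
Proof.
move=> cop_fp; apply/eqP/row_freeP; apply/row_freeP/inj_row_free => u.
move/companion_ker; rewrite Gauss_dvdpl // => f_u.
rewrite -[u]rVpolyK; have [-> | u0] := eqVneq (rVpoly u) 0; first exact: linear0.
by have := dvdp_leq u0 f_u; rewrite leqNgt size_rVpoly_lt.
Qed.

(** The multiples of p by the polynomials of degree less than that of r stay below
the degree of f, so they span a space of dimension deg r in the image; the same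
bound for r, and p(C) r(C) = 0, give the equality. *)
Lemma rank_companion_dvd p r : f = p * r -> \rank (mxev C p) = (size r).-1.
Proof.
suff ge_rk p1 r1 : f = p1 * r1 -> ((size r1).-1 <= \rank (mxev C p1))%N.
  move=> fE; apply/eqP; rewrite eqn_leq ge_rk // andbT.
  have /mulmx0_rank_max : mxev C p *m mxev C r = 0.
    by rewrite -mxevM -fE mxev_companion0.
  have := ge_rk r p; rewrite mulrC => /(_ fE).
  have szf : ((size f).-1 = (size p).-1 + (size r).-1)%N.
    move: (f0); rewrite fE mulf_eq0 negb_or => /andP[p0 r0].
    rewrite size_mul // -[size p]prednK ?size_poly_gt0 //.
    by rewrite -[size r]prednK ?size_poly_gt0 // addSn addnS.
  move: (\rank _) (\rank _) => a b le1; rewrite szf => le2.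
  by rewrite -(leq_add2l (size p).-1) (leq_trans _ le2) // addnC leq_add2l.
move=> fE.
have /andP[p0 r0] : (p1 != 0) && (r1 != 0).
  by rewrite -negb_or -mulf_eq0 -fE.
pose U : 'M[F]_((size r1).-1, (size f).-1) := \matrix_i poly_rV 'X^i.
have uU (u : 'rV_(size r1).-1) : rVpoly (u *m U) = rVpoly u.
  rewrite mulmx_sum_row linear_sum /= [u in RHS]row_sum_delta linear_sum /=.
  apply: eq_bigr => i _; rewrite !linearZ /= rowK rVpoly_delta poly_rV_K //.
  rewrite size_polyXn fE size_mul // (leq_trans (ltn_ord i)) //.
  rewrite -[size p1]prednK ?size_poly_gt0 // addSn /=.
  by rewrite -subn1 -[X in (_ <= X)%N]subn1 leq_sub2r ?leq_addl.
suff /eqP <- : row_free (U *m mxev C p1) by apply: mxrankM_maxr.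
apply: inj_row_free => u; rewrite mulmxA => /companion_ker.
rewrite uU mulrC fE dvdp_mul2l // => r1_u; rewrite -[u]rVpolyK.
have [-> | u0] := eqVneq (rVpoly u) 0; first exact: linear0.
have := dvdp_leq u0 r1_u; rewrite leqNgt -[X in (_ < X)%N]prednK ?size_poly_gt0 //.
by rewrite ltnS size_poly.
Qed.

End Companion.

(** * Existence of the primary cyclic decomposition *)

Section Split.
Variables (F : fieldType).

(** Splitting off the cyclic module generated by v.  The functional l provides the
complement: with P the rows v A^i and Q the columns A^j l, the nondegeneracy
hypothesis says that the Hankel matrix P Q is invertible, so the row space of P
is a complement of the kernel of Q; the latter is A-stable because f(A) l = 0
makes the column space of Q stable. *)
Lemma cyclic_summand n (A : 'M[F]_n) f (v : 'rV_n) (l : 'cV_n) :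
  f \is monic -> (1 < size f)%N ->
  v *m mxev A f = 0 -> mxev A f *m l = 0 ->
  (forall u : {poly F}, (size u < size f)%N ->
     (forall p, v *m mxev A (u * p) *m l = 0) -> u = 0) ->
  exists r (A' : 'M[F]_r), mxsim A (block_mx (companionmx f) 0 0 A').
Proof.
move=> f_monic f_gt1 vf0 fl0 nondeg; set C := companionmx f.
have fE p : p = (p %/ f)%R * f + (p %% f)%R by rewrite -divp_eq.
have vmod p : v *m mxev A p = v *m mxev A (p %% f).
  by rewrite {1}(fE p) mulrC mxevD mxevM mulmxDr mulmxA vf0 mul0mx add0r.
have modl p : mxev A p *m l = mxev A (p %% f) *m l.
  by rewrite {1}(fE p) mxevD mxevM mulmxDl -mulmxA fl0 mulmx0 add0r.
pose P := \matrix_(i < (size f).-1) (v *m mxev A 'X^i).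
pose Q := \matrix_(j < n, i < (size f).-1) (mxev A 'X^i *m l) j 0.
have uP u : u *m P = v *m mxev A (rVpoly u).
  rewrite mulmx_sum_row [u in RHS]row_sum_delta linear_sum /=.
  rewrite (big_morph _ (mxevD A) (mxev0 A)) mulmx_sumr; apply: eq_bigr => i _.
  by rewrite rowK linearZ /= rVpoly_delta -mul_polyC mxevM mxevC mul_scalar_mx
             scalemxAr.
have colQ i : col i Q = mxev A 'X^i *m l.
  by apply/matrixP => j k; rewrite !mxE ord1.
(* Since f(A) l = 0, the columns of Q span all the p(A) l. *)
have kerQ (x : 'rV_n) : x *m Q = 0 -> forall p, x *m mxev A p *m l = 0.
  move=> xQ p; rewrite -mulmxA modl.
  have : (size (p %% f)%R <= (size f).-1)%N.
    by rewrite -ltnS prednK ?ltn_modp ?monic_neq0 // ltnW.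
  move: (p %% f) => r /poly_rV_K <-.
  rewrite [poly_rV r]row_sum_delta linear_sum /=.
  rewrite (big_morph _ (mxevD A) (mxev0 A)) mulmx_suml mulmx_sumr big1 // => i _.
  rewrite linearZ /= rVpoly_delta -mul_polyC mxevM mxevC mul_scalar_mx.
  by rewrite -scalemxAl -colQ -scalemxAr colE mulmxA xQ mul0mx scaler0.
have PA : P *m A = C *m P.
  apply/row_matrixP => i; rewrite !rowE !mulmxA !uP rVpoly_companion // -vmod.
  by rewrite mxevM mxevX mulmxA.
have PQfree : row_free (P *m Q).
  apply: inj_row_free => u; rewrite mulmxA => /kerQ uPQ.
  rewrite -[u]rVpolyK [rVpoly u]nondeg ?linear0 //; first exact: size_rVpoly_lt.
  by move=> p; rewrite mxevM mulmxA -uP uPQ.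
have rkQ : \rank Q = (size f).-1.
  apply/eqP; rewrite eqn_leq rank_leq_col -{1}(eqP PQfree).
  exact: mxrankM_maxr.
pose K := row_base (kermx Q); set r := \rank (kermx Q) in K *.
have KQ : K *m Q = 0 by apply/sub_kermxP; rewrite eq_row_base.
have KA : (K *m A <= K)%MS.
  rewrite eq_row_base; apply/sub_kermxP/matrixP => i j.
  have /kerQ/(_ ('X * 'X^j)) : row i K *m Q = 0 by rewrite -row_mul KQ row0.
  rewrite mxevM mxevX mulmxA -mulmxA -colQ colE mulmxA -colE -!row_mul.
  by move=> /matrixP/(_ 0 0); rewrite !mxE.
exists r, (K *m A *m pinvmx K); apply: mxsim_sym.
have eqn : ((size f).-1 + r = n)%N.
  by rewrite /r mxrank_ker rkQ subnKC // -rkQ rank_leq_row.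
(* Q kills K but is injective on the row space of P. *)
have PKfree : row_free (col_mx P K).
  apply: inj_row_free => u; rewrite -[u]hsubmxK mul_row_col => uPK.
  have u1 : lsubmx u = 0.
    apply/eqP; rewrite -(mulmx_free_eq0 _ PQfree) mulmxA.
    by rewrite (canRL (addrK _) uPK) sub0r mulNmx -mulmxA KQ mulmx0 oppr0.
  move: uPK; rewrite u1 mul0mx add0r => /eqP.
  by rewrite mulmx_free_eq0 ?row_base_free // => /eqP ->; rewrite row_mx0.
apply: (@mxsim_intertw _ _ _ _ _ (col_mx P K)) => //.
  by rewrite /row_full (eqP PKfree) eqn.
by rewrite mul_block_col !mul0mx addr0 add0r mul_col_mx PA mulmxKpV.
Qed.

End Split.

Section PrimaryForm.
Variables (F : fieldType).
Implicit Types (x : {poly F} * nat) (s : seq ({poly F} * nat)).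

(** The pair (f, k) stands for the module F[X] / (f^k). *)
Definition primary x := [/\ x.1 \is monic, irreducible_poly x.1 & (0 < x.2)%N].

Fixpoint bsize s := if s is x :: s' then ((size (x.1 ^+ x.2)).-1 + bsize s')%N else 0%N.

Fixpoint bdiag s : 'M[F]_(bsize s) :=
  if s is x :: s' then block_mx (companionmx (x.1 ^+ x.2)) 0 0 (bdiag s') else 0.

Lemma block_mx0l n (B : 'M[F]_n) : block_mx (0 : 'M_0) 0 0 B = B.
Proof.
apply/matrixP => i j; rewrite /block_mx mxE; case: splitP => [[]//|i' ii'].
rewrite mxE; case: splitP => [[]//|j' jj'].
by congr (B _ _); apply: val_inj.
Qed.

Lemma mxsim_bdiag_cat s1 s2 :
  mxsim (bdiag (s1 ++ s2)) (block_mx (bdiag s1) 0 0 (bdiag s2)).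
Proof.
elim: s1 => [|x s1 IHs] /=; first by rewrite block_mx0l; apply: mxsim_refl.
apply: (mxsim_trans _ (mxsim_blockA _ _ _)).
exact: mxsim_block (mxsim_refl _) IHs.
Qed.

Lemma mxsim_bdiag_perm s1 s2 : perm_eq s1 s2 -> mxsim (bdiag s1) (bdiag s2).
Proof.
move=> eq_s; pose P s := mxsim (bdiag s1) (bdiag s).
apply: (@catCA_perm_ind _ P) eq_s _; last exact: mxsim_refl.
move=> t1 t2 t3; rewrite /P => /mxsim_trans; apply.
rewrite !catA; apply: (mxsim_trans (mxsim_bdiag_cat _ _)).
apply: mxsim_trans (mxsim_sym (mxsim_bdiag_cat _ _)).
apply: mxsim_block (mxsim_refl _).
apply: (mxsim_trans (mxsim_bdiag_cat _ _)).
apply: mxsim_trans (mxsim_sym (mxsim_bdiag_cat _ _)).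
exact: mxsim_blockC.
Qed.

Lemma irreducible_factor (p : {poly F}) : (1 < size p)%N ->
  exists2 f, monic_irreducible_poly f & f %| p.
Proof.
elim: {p}(size p) {-2}p (leqnn (size p)) => [|n IHn] p le_pn p_gt1.
  by have := leq_trans p_gt1 le_pn.
have p0 : p != 0 by rewrite -size_poly_gt0 ltnW.
case: (pselect (exists q : {poly F}, [/\ q %| p, size q != 1 & ~~ (q %= p)])).
  move=> [q [q_p q1 q_np]].
  have q0 : q != 0 by apply: contraNneq p0 => q0; rewrite q0 dvd0p in q_p.
  have [|| f fI f_q] := IHn q; last by exists f; rewrite ?(dvdp_trans f_q).
    by rewrite -ltnS (leq_trans _ le_pn) // ltn_neqAle dvdp_leq // andbT dvdp_size_eqp.
  by rewrite ltn_neqAle eq_sym q1 size_poly_gt0.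
move=> p_irr; exists ((lead_coef p)^-1 *: p); last first.
  by rewrite dvdpZl ?invr_eq0 ?lead_coef_eq0.
have lc0 : (lead_coef p)^-1 != 0 by rewrite invr_eq0 lead_coef_eq0.
split; last by rewrite monicE lead_coefZ mulVf // lead_coef_eq0.
split; first by rewrite size_scale.
move=> q q1; rewrite dvdpZr // => q_p.
rewrite eqp_sym (eqp_trans (eqp_scale _ lc0)) // eqp_sym.
by case: (boolP (q %= p)) => // q_np; case: p_irr; exists q.
Qed.

Lemma factor_power (f p : {poly F}) : (1 < size f)%N -> p != 0 ->
  exists i w, p = f ^+ i * w /\ ~~ (f %| w).
Proof.
move=> f_gt1 p0; have f0 : f != 0 by rewrite -size_poly_gt0 ltnW.
have exk : exists k, ~~ (f ^+ k %| p).
  exists (size p); apply/negP => /(dvdp_leq p0); apply/negP; rewrite -ltnNge.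
  rewrite -[X in (_ < X)%N]prednK ?size_poly_gt0 ?expf_neq0 //.
  by rewrite size_exp ltnS leq_pmull // -ltnS prednK // ltnW.
case: (ex_minnP exk) => [[|k]] kP k_min; first by rewrite dvd1p in kP.
have /dvdpP[w pE] : f ^+ k %| p.
  by have := k_min k; rewrite ltnn; case: (_ %| _) => // /(_ isT).
exists k, w; rewrite mulrC; split=> //; apply: contra kP => f_w.
by rewrite pE exprS dvdp_mul.
Qed.

(** Choose an irreducible factor f of the minimal polynomial f^k g, with f not
dividing g.  The matrix (g f^(k-1) g)(A) is nonzero, so it has a nonzero entry
(i, j); take for v and l the row i and the column j of g(A).  Both are killed by
f^k, and nondegeneracy holds because every nonzero ideal of F[X] / (f^k)
contains f^(k-1), on which the pairing does not vanish. *)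
Lemma primary_form n (A : 'M[F]_n) :
  exists2 s, {in s, forall x, primary x} & mxsim A (bdiag s).
Proof.
elim: n {-2}n (leqnn n) A => [|m IHm] n le_nm A.
  case: n A le_nm => // A _; exists [::] => //=.
  by rewrite flatmx0; apply: mxsim_refl.
case: n A le_nm => [|n] A le_nm; first by apply: IHm.
have [] := @irreducible_factor (mxminpoly A).
  by rewrite size_mxminpoly ltnS mxminpoly_nonconstant.
move=> f [f_irr f_monic] f_p.
have p0 : mxminpoly A != 0 by rewrite monic_neq0 ?mxminpoly_monic.
have f_gt1 : (1 < size f)%N by case: f_irr.
have f0 : f != 0 by rewrite monic_neq0.
have [k [g [gE f_g]]] := factor_power f_gt1 p0.
have k_gt0 : (0 < k)%N.
  by case: k gE => // gE; rewrite gE mul1r (negPf f_g) in f_p.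
have g0 : g != 0 by apply: contraNneq f_g => ->; rewrite dvdp0.
have minA q : (mxminpoly A %| q) = (mxev A q == 0) by apply: dvd_mxminpoly.
have h0 : f ^+ k.-1 * g != 0 by rewrite mulf_neq0 ?expf_neq0.
have : mxev A (g * f ^+ k.-1 * g) != 0.
  have -> : g * f ^+ k.-1 * g = g * (f ^+ k.-1 * g) by rewrite mulrA.
  have fE : f ^+ k * g = f * (f ^+ k.-1 * g) by rewrite mulrA -exprS prednK.
  by rewrite -minA gE fE dvdp_mul2r.
rewrite !mxevM => /matrix0Pn[i [j Aij0]].
pose v := row i (mxev A g); pose l := col j (mxev A g).
have vl0 : v *m mxev A (f ^+ k.-1) *m l != 0.
  apply: contraNneq Aij0; rewrite /v /l -row_mul colE mulmxA -colE -row_mul.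
  by move=> /matrixP/(_ 0 0); rewrite !mxE => ->.
have A_fk : mxev A (f ^+ k * g) = 0 by apply/eqP; rewrite -minA gE.
have [|||||r [A' sAA']] := @cyclic_summand F _ A (f ^+ k) v l.
- exact: monic_exp.
- by rewrite -ltn_predRL size_exp muln_gt0 ltn_predRL f_gt1.
- by rewrite /v -row_mul -mxevM mulrC A_fk row0.
- by rewrite /l colE mulmxA -mxevM A_fk mul0mx.
- move=> u u_lt uP; apply/eqP; apply: contraNT vl0 => u0.
  have [a [w [uE f_w]]] := factor_power f_gt1 u0.
  have lt_ak : (a < k)%N.
    rewrite ltnNge; apply: contraTN u_lt => le_ka; rewrite -leqNgt.
    by rewrite dvdp_leq // uE dvdp_mulr // dvdp_exp2l.
  have /Bezout_eq1_coprimepP[[b c] /= bc1] : coprimep w (f ^+ k).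
    by rewrite coprimep_sym coprimep_expl // irreducible_poly_coprime.
  (* With u = f^a w, the multiple u f^(k - 1 - a) w^-1 of u is f^(k-1) mod f^k. *)
  have eP : u * (f ^+ (k.-1 - a) * b) = f ^+ k.-1 - f ^+ k * (f ^+ k.-1 * c).
    have bwE : b * w = 1 - c * f ^+ k by apply/eqP; rewrite -bc1 addrK.
    rewrite uE mulrACA -exprD subnKC; last by rewrite -ltnS prednK.
    rewrite [w * b]mulrC bwE mulrBr mulr1; congr (_ - _).
    by rewrite [LHS]mulrA [RHS]mulrC.
  have := uP (f ^+ (k.-1 - a) * b); rewrite eP => /eqP; apply: contraLR.
  rewrite -mulrN mxevD mxevM mulmxDr mulmxDl.
  by rewrite mulmxA /v -[row i _ *m mxev A (f ^+ k)]row_mul -mxevM mulrC A_fk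
     row0 !mul0mx addr0.
have szE := mxsim_size sAA'.
have [|s s_prim sA's] := IHm r _ A'.
  rewrite -ltnS (leq_trans _ le_nm) // szE -[X in (X < _)%N]add0n ltn_add2r.
  by rewrite size_exp muln_gt0 ltn_predRL f_gt1.
exists ((f, k) :: s); last first.
  by apply: (mxsim_trans sAA'); apply: mxsim_block sA's; apply: mxsim_refl.
by move=> x; rewrite inE => /predU1P[-> // | /s_prim].
Qed.

End PrimaryForm.

(** * Multiplicities as similarity invariants *)

Section Mult.
Variables (F : fieldType).
Implicit Types (x : {poly F} * nat) (s : seq ({poly F} * nat)).
Implicit Types (f : {poly F}).

Lemma bsizeE s : bsize s = (\sum_(x <- s) (size x.1).-1 * x.2)%N.
Proof.
by elim: s => [|x s IHs]; rewrite ?big_nil // big_cons -IHs /= size_exp.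
Qed.

(** On F[X] / (f^k) the image of f^i has dimension (k - i) deg f, or 0 if i > k; on
the blocks prime to f it is invertible. *)
Lemma rank_bdiag s f i : {in s, forall x, primary x} -> monic_irreducible_poly f ->
  \rank (mxev (bdiag s) (f ^+ i)) =
  (\sum_(x <- s) (size x.1).-1 * (if x.1 == f then x.2 - i else x.2))%N.
Proof.
move=> s_prim [f_irr f_monic]; elim: s s_prim => [|x s IHs] s_prim.
  by rewrite big_nil; apply/eqP; rewrite -leqn0 rank_leq_row.
rewrite big_cons /= mxev_block rank_diag_block_mx IHs; last first.
  by move=> y s_y; apply: s_prim; rewrite inE s_y orbT.
have [x_monic x_irr x_gt0] : primary x by apply: s_prim; rewrite mem_head.
have xk_monic : x.1 ^+ x.2 \is monic by exact: monic_exp.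
have xk_gt1 : (1 < size (x.1 ^+ x.2))%N.
  by rewrite -ltn_predRL size_exp muln_gt0 ltn_predRL x_irr.1.
congr (_ + _)%N; have [<- | ne_xf] := eqVneq x.1 f; last first.
  rewrite rank_companion_coprime ?size_exp // coprimep_expl // coprimep_expr //.
  rewrite irreducible_poly_coprime //; apply: contra ne_xf => x_f.
  rewrite -eqp_monic //; apply: f_irr.2 => //.
  by rewrite neq_ltn x_irr.1 orbT.
have [le_ix | lt_xi] := leqP i x.2.
  rewrite (@rank_companion_dvd _ _ _ _ _ (x.1 ^+ (x.2 - i))) ?size_exp //.
  by rewrite -exprD subnKC.
have /eqP-> : (x.2 - i == 0)%N by rewrite subn_eq0 ltnW.
by rewrite mxev_companion0 ?mxrank0 ?muln0 // dvdp_exp2l // ltnW.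
Qed.

(** The number of blocks (f, k) of the primary form, expressed by ranks so that it
is visibly a similarity invariant: the second difference at i = k of the
function i |-> max(l - i, 0) is 1 if l = k and 0 otherwise. *)
Definition mult n (A : 'M[F]_n) f k :=
  ((\rank (mxev A (f ^+ k.-1)) + \rank (mxev A (f ^+ k.+1))
     - 2 * \rank (mxev A (f ^+ k))) %/ (size f).-1)%N.

Lemma count_rank s f k : {in s, forall x, primary x} -> monic_irreducible_poly f ->
  (0 < k)%N ->
  (\rank (mxev (bdiag s) (f ^+ k.-1)) + \rank (mxev (bdiag s) (f ^+ k.+1)) =
   2 * \rank (mxev (bdiag s) (f ^+ k)) + (size f).-1 * count_mem (f, k) s)%N.
Proof.
move=> s_prim fI k_gt0; rewrite !rank_bdiag //.
rewrite -sum1_count !big_distrr /= -big_split (big_mkcond (pred1 _)) /=.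
rewrite -big_split; apply: eq_bigr => -[g l] _ /=.
rewrite xpair_eqE; case: eqP => [-> | _] /=; last first.
  by rewrite addn0 mul2n addnn.
have -> (b : bool) : (if b then (size f).-1 * 1 else 0)%N = ((size f).-1 * b)%N.
  by case: b; rewrite ?muln0.
rewrite mulnCA -!mulnDr; congr (_ * _)%N.
case: k k_gt0 => // k _ /=; rewrite mul2n -addnn.
by have [] := ltngtP l k.+1; lia.
Qed.

Lemma mult_bdiag n (A : 'M[F]_n) s f k :
  mxsim A (bdiag s) -> {in s, forall x, primary x} -> monic_irreducible_poly f ->
  (0 < k)%N -> mult A f k = count_mem (f, k) s.
Proof.
move=> sA s_prim fI k_gt0; rewrite /mult.
rewrite !(fun p => mxsim_rank (mxsim_mxev p sA)) count_rank // addKn mulKn //.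
by rewrite ltn_predRL fI.1.1.
Qed.

Lemma mult_rank n (A : 'M[F]_n) f k : monic_irreducible_poly f -> (0 < k)%N ->
  (\rank (mxev A (f ^+ k.-1)) + \rank (mxev A (f ^+ k.+1)) =
   2 * \rank (mxev A (f ^+ k)) + (size f).-1 * mult A f k)%N.
Proof.
move=> fI k_gt0; have [s s_prim sA] := primary_form A.
rewrite (mult_bdiag sA) // !(fun p => mxsim_rank (mxsim_mxev p sA)).
exact: count_rank.
Qed.

Lemma mxsim_mult n m (A : 'M[F]_n) (B : 'M[F]_m) :
  (forall f k, monic_irreducible_poly f -> (0 < k)%N -> mult A f k = mult B f k) ->
  mxsim A B.
Proof.
move=> eqAB; have [s s_prim sA] := primary_form A.
have [t t_prim tB] := primary_form B.
apply: (mxsim_trans sA); apply: mxsim_trans (mxsim_sym tB).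
apply: mxsim_bdiag_perm; apply/allP => -[f k]; rewrite mem_cat => st_fk.
have [f_monic f_irr k_gt0] : primary (f, k).
  by case/orP: st_fk => [/s_prim | /t_prim].
by rewrite /= -(mult_bdiag sA) -?(mult_bdiag tB) ?eqAB.
Qed.

Lemma mult_sim n m (A : 'M[F]_n) (B : 'M[F]_m) f k : mxsim A B ->
  mult A f k = mult B f k.
Proof.
by move=> sAB; rewrite /mult !(fun p => mxsim_rank (mxsim_mxev p sAB)).
Qed.

Lemma mult_unit n (A : 'M[F]_n) k : A \in unitmx -> (0 < k)%N -> mult A 'X k = 0%N.
Proof.
move=> uA k_gt0; have rk i : \rank (mxev A ('X ^+ i)) = n.
  apply: mxrank_unit; elim: i => [|i IHi]; first by rewrite mxev1 unitmx1.
  by rewrite exprS mxevM mxevX unitmx_mul uA.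
by rewrite /mult !rk mul2n addnn subnn div0n.
Qed.

Lemma bdiag_unit s : {in s, forall x, primary x} ->
  {in s, forall x, x.1 != 'X} -> bdiag s \in unitmx.
Proof.
move=> s_prim s_X; rewrite -row_free_unit /row_free -{1}[bdiag s]mxevX -['X]expr1.
rewrite rank_bdiag //.
  rewrite bsizeE; apply/eqP/eq_big_seq => x /s_X /negPf -> //.
split; last exact: monicX.
by have := irredp_XsubC (0 : F); rewrite subr0.
Qed.

End Mult.

(** * Powers and multiplicities *)

Section Powers.
Variables (F : fieldType) (M : nat).
Implicit Types (x : {poly F} * nat) (s : seq ({poly F} * nat)).

Definition mpow n (A : 'M[F]_n) := exists B, mxev B 'X^M = A.

Lemma mpow_sim n m (A : 'M[F]_n) (B : 'M[F]_m) : mxsim A B -> mpow B -> mpow A.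
Proof.
move=> [P [Q [PQ QP AP]]] [C CB]; exists (P *m C *m Q).
have /mxev_intertw CP : (P *m C *m Q) *m P = P *m C.
  by rewrite -!mulmxA QP mulmx1.
by rewrite -[LHS]mulmx1 -PQ mulmxA CP CB -AP -mulmxA PQ mulmx1.
Qed.

Lemma mpow_block n m (A : 'M[F]_n) (B : 'M[F]_m) :
  mpow A -> mpow B -> mpow (block_mx A 0 0 B).
Proof. by move=> [C <-] [D <-]; exists (block_mx C 0 0 D); rewrite mxev_block. Qed.

Lemma mpow_cat s t : mpow (bdiag s) -> mpow (bdiag t) -> mpow (bdiag (s ++ t)).
Proof.
by move=> ps pt; apply: (mpow_sim (mxsim_bdiag_cat _ _)); apply: mpow_block.
Qed.

Lemma mpow_nil : mpow (bdiag [::] : 'M[F]__).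
Proof. by exists 0; rewrite flatmx0 [RHS]flatmx0. Qed.

Lemma mpow_nseq a b x : mpow (bdiag (nseq a x)) -> mpow (bdiag (nseq (b * a) x)).
Proof.
move=> px; elim: b => [|b IHb]; first exact: mpow_nil.
by rewrite mulSn nseqD; apply: mpow_cat.
Qed.

Lemma perm_nseq_filter s x :
  perm_eq s (nseq (count_mem x s) x ++ filter (predC1 x) s).
Proof.
rewrite perm_sym (_ : nseq _ _ = filter (pred1 x) s) ?perm_filterC //.
elim: s => //= y s IHs; rewrite -IHs.
by case: eqP => [-> | _].
Qed.

(** Equal blocks are grouped, since a block may be an M-th power only together with
other copies of itself. *)
Lemma mpow_bdiag s :
  (forall x, x \in s -> exists2 a, (a %| count_mem x s)%N & mpow (bdiag (nseq a x))) ->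
  mpow (bdiag s).
Proof.
elim: {s}(size s).+1 {-2}s (ltnSn (size s)) => // n IHn s.
rewrite ltnS => le_sn s_pow.
have [-> | [x s_x]] : s = [::] \/ exists x, x \in s.
- by case: (s) => [|x t]; [left | right; exists x; apply: mem_head].
- exact: mpow_nil.
apply: (mpow_sim (mxsim_bdiag_perm (perm_nseq_filter s x))); apply: mpow_cat.
  by have [a /dvdnP[b ->]] := s_pow x s_x; apply: mpow_nseq.
apply: IHn => [|y].
  rewrite (leq_trans _ le_sn) // size_filter -(count_predC (pred1 x) s).
  by rewrite -[X in (X < _)%N]add0n ltn_add2r -has_count has_pred1.
rewrite mem_filter => /andP[/= y_x /s_pow[a a_s pa]]; exists a => //.
rewrite count_filter (_ : count _ s = count_mem y s) //.
by apply: eq_count => z /=; case: eqP => // ->; rewrite y_x.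
Qed.

Lemma mpow_good f k :
  (exists g : {poly F}, f ^+ k %| g ^+ M - 'X) -> f ^+ k \is monic ->
  (1 < size (f ^+ k))%N -> mpow (bdiag [:: (f, k)]).
Proof.
move=> [g fg] fk_monic fk_gt1; apply: mpow_block mpow_nil => /=.
exists (mxev (companionmx (f ^+ k)) g).
rewrite -mxev_comp comp_Xn_poly -[g ^+ M](subrK 'X) mxevD mxevX.
by rewrite mxev_companion0 ?add0r.
Qed.

Hypothesis M_gt0 : (0 < M)%N.

Lemma size_comp_Xn (f : {poly F}) : (size (f \Po 'X^M)).-1 = ((size f).-1 * M)%N.
Proof. by rewrite size_comp_poly size_polyXn. Qed.

Lemma monic_comp_Xn (f : {poly F}) : f \is monic -> f \Po 'X^M \is monic.
Proof.
move=> f_monic; rewrite monicE lead_coef_comp ?size_polyXn //.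
by rewrite (eqP f_monic) lead_coefXn expr1n mulr1.
Qed.

(** Since f(B^M) = g(B) for g = f(X^M), the matrices B^M and B have the same ranks
at f^i and g^i; but deg g = M deg f. *)
Lemma mult_mpow n (B : 'M[F]_n) f k :
  monic_irreducible_poly f -> irreducible_poly (f \Po 'X^M) -> (0 < k)%N ->
  mult (mxev B 'X^M) f k = (M * mult B (f \Po 'X^M) k)%N.
Proof.
move=> fI g_irr k_gt0; set g := f \Po _ in g_irr *.
have gI : monic_irreducible_poly g.
  by split; last by apply: monic_comp_Xn; case: fI.
have E i : mxev (mxev B 'X^M) (f ^+ i) = mxev B (g ^+ i).
  by rewrite -mxev_comp rmorphXn.
have := mult_rank (mxev B 'X^M) fI k_gt0; rewrite !E (mult_rank B gI k_gt0).
move/eqP; rewrite eqn_add2l size_comp_Xn -mulnA eqn_pmul2l => [/eqP<- //|].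
by rewrite ltn_predRL fI.1.1.
Qed.

(** The M-th power of the companion matrix of f(X^M)^k: by [mult_mpow] it contains
the block (f, k) with multiplicity M, and there is no room for any other. *)
Lemma mpow_bad f k :
  monic_irreducible_poly f -> irreducible_poly (f \Po 'X^M) -> (0 < k)%N ->
  mpow (bdiag (nseq M (f, k))).
Proof.
move=> fI g_irr k_gt0; set g := f \Po _ in g_irr.
have gI : monic_irreducible_poly g.
  by split; last by apply: monic_comp_Xn; case: fI.
pose B : 'M[F]__ := bdiag [:: (g, k)].
have [s s_prim sB] := primary_form (mxev B 'X^M).
suff /mxsim_bdiag_perm/mxsim_sym sE : perm_eq s (nseq M (f, k)).
  by apply: (mpow_sim (mxsim_trans sE (mxsim_sym sB))); exists B.
have s_count : count_mem (f, k) s = M.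
  rewrite -(mult_bdiag sB) // mult_mpow // (@mult_bdiag _ _ B [:: (g, k)]) //.
  - by rewrite /= eqxx muln1.
  - exact: mxsim_refl.
  - by move=> x; rewrite inE => /eqP->; split; case: gI.
(* The M blocks (f, k) already fill the whole space. *)
have := perm_nseq_filter s (f, k); rewrite s_count => s_perm.
have := mxsim_size sB; rewrite !bsizeE (perm_big _ s_perm) /= big_cat /=.
rewrite big_nseq iter_addn_0 big_seq1 /= size_comp_Xn mulnAC => /eqP.
rewrite -[X in X == _]addn0 eqn_add2l eq_sym sum_nat_seq_eq0 => /allP flt0.
suff flt : [seq x <- s | predC1 (f, k) x] = [::] by rewrite flt cats0 in s_perm.
case E: (filter _ _) flt0 => [//|x t] /(_ x (mem_head _ _)) /=.
have /s_prim[_ x_irr x_gt0] : x \in s.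
  by have := mem_head x t; rewrite -E mem_filter => /andP[].
by rewrite muln_eq0 !eqn0Ngt x_gt0 ltn_predRL x_irr.1.
Qed.

End Powers.

(** * The order of X modulo an irreducible polynomial *)

Section Residue.
Variables (F : finFieldType).
Implicit Types (f g p : {poly F}).
Local Notation q := #|F|.
Local Notation deg f := (size f).-1.

Lemma residue_field f : monic_irreducible_poly f ->
  exists (K : finFieldType) (c : {rmorphism {poly F} -> K}),
    [/\ #|K| = (q ^ deg f)%N, forall y, exists p, y = c p
      & forall p, (c p == 0) = (f %| p)].
Proof.
move=> fI; pose K : finFieldType := {poly %/ f with fI}.
pose c0 : {poly F} -> K := in_qpoly f.
pose c : {rmorphism {poly F} -> K} := GRing.RMorphism.clone _ _ c0 (in_qpoly f).
exists K, c; split.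
- exact: card_qfpoly.
- move=> y; exists (val y); apply: val_inj => /=.
  by rewrite Pdiv.CommonRing.rmodp_small // size_mk_monic.
move=> p; rewrite -val_eqE /= /c0 /= (mk_monicE fI).
by rewrite -Pdiv.IdomainMonic.modpE ?fI.2.
Qed.

Lemma pchar_nat_card e : [pchar {poly F}].-nat (q ^ e)%N.
Proof.
have [p p_pr pF] := finPcharP F.
have /abelem_pgroup : (p.-abelem [set: F])%g by apply: fin_ring_pchar_abelem.
rewrite /pgroup cardsT => qp; rewrite pnatX (sub_in_pnat _ qp) // => r _ /eqP->.
by rewrite pchar_poly.
Qed.

Lemma poly_Frobenius p e : p ^+ (q ^ e) = p \Po 'X^(q ^ e).
Proof.
have qe_gt0 : (0 < q ^ e)%N by rewrite expn_gt0 (ltnW (finNzRing_gt1 F)).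
elim/poly_ind: p => [|p c IHp].
  by rewrite comp_poly0 expr0n gtn_eqF.
rewrite comp_poly_MXaddC exprDn_pchar ?pchar_nat_card // exprMn IHp -rmorphXn /=.
congr (_ + _%:P); elim: e {IHp qe_gt0} => [|e IHe]; first by rewrite expr1.
by rewrite expnS exprM expf_card.
Qed.

Lemma dvdn_pred_exp b d e : (1 < b)%N -> (0 < d)%N ->
  ((b ^ d).-1 %| (b ^ e).-1)%N = (d %| e)%N.
Proof.
move=> b_gt1 d_gt0; have b_gt0 n : (0 < b ^ n)%N by rewrite expn_gt0 ltnW.
have dvdM n : ((b ^ d).-1 %| (b ^ (n * d)).-1)%N.
  by rewrite mulnC expnM (predn_exp (b ^ d)) dvdn_mulr.
apply/idP/idP => [|/dvdnP[n ->] //].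
rewrite {1}(divn_eq e d) expnD.
have predM m n : (0 < m)%N -> (0 < n)%N -> (m * n).-1 = (m.-1 * n + n.-1)%N.
  by move=> m_gt0 n_gt0; rewrite -[in LHS](prednK m_gt0) mulSn; lia.
rewrite (predM (b ^ (e %/ d * d))%N) // dvdn_addr; last by rewrite dvdn_mulr.
have [r0|r_gt0 /dvdn_leq] := posnP (e %% d); first by rewrite /dvdn r0.
have := ltn_pmod e d_gt0; rewrite -(ltn_exp2l _ _ b_gt1).
have := b_gt0 (e %% d)%N.
have: (b ^ 0 < b ^ (e %% d))%N by rewrite ltn_exp2l.
by rewrite expn0; lia.
Qed.

Lemma irreducible_X : irreducible_poly ('X : {poly F}).
Proof. by have := irredp_XsubC (0 : F); rewrite subr0. Qed.

Lemma ndvdp_X f : monic_irreducible_poly f -> f != 'X -> ~~ (f %| 'X).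
Proof.
move=> fI; apply: contra => f_dvdX; rewrite -eqp_monic ?monicX ?fI.2 //.
by apply: irreducible_X.2 => //; rewrite neq_ltn fI.1.1 orbT.
Qed.

Lemma order_X f : monic_irreducible_poly f -> f != 'X ->
  exists2 o, (0 < o)%N & forall a, (f %| 'X^a - 1) = (o %| a)%N.
Proof.
move=> fI f_X; have [K [c [cardK c_surj c0]]] := residue_field fI.
have Ux : c 'X \is a GRing.unit.
  by rewrite unitfE c0; apply: ndvdp_X.
exists #[FinRing.unit K Ux]%g => [|a]; first exact: order_gt0.
rewrite order_dvdn -c0 rmorphB rmorph1 rmorphXn subr_eq0 -val_eqE /=.
by rewrite FinRing.val_unitX.
Qed.

(** Let x be the image of X in the field K = F[X] / (f).  If x^(q^e) = x, then the Frobenius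
power y |-> y^(q^e) fixes the whole of K, as x generates K; applied to a
generator of the cyclic group of units this gives q^d - 1 | q^e - 1. *)
Lemma dvdp_Xq f e : monic_irreducible_poly f -> f != 'X ->
  (f %| 'X^((q ^ e).-1) - 1) = (deg f %| e)%N.
Proof.
move=> fI f_X; have [K [c [cardK c_surj c0]]] := residue_field fI.
have q_gt1 : (1 < q)%N by apply: finNzRing_gt1.
have qe_gt0 n : (0 < q ^ n)%N by rewrite expn_gt0 ltnW.
have eq1 a : (f %| 'X^a - 1) = (c 'X ^+ a == 1).
  by rewrite -c0 rmorphB rmorph1 rmorphXn subr_eq0.
have cX0 : c 'X != 0.
  have [o o_gt0 oP] := order_X fI f_X.
  have := oP o; rewrite dvdnn eq1 => /eqP; apply: contra_eq_neq => ->.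
  by rewrite expr0n gtn_eqF // eq_sym oner_eq0.
apply/idP/idP; last first.
  move=> /dvdnP[b ->]; rewrite eq1 mulnC expnM -cardK predn_exp exprM.
  suff -> : c 'X ^+ #|K|.-1 = 1 by rewrite expr1n.
  apply: (mulfI cX0); rewrite -exprS prednK ?mulr1 ?expf_card //.
  by rewrite (ltnW (finNzRing_gt1 K)).
move=> fe.
have Xe : c 'X ^+ (q ^ e) = c 'X.
  by rewrite -(prednK (qe_gt0 e)) exprS; move: fe; rewrite eq1 => /eqP ->; rewrite mulr1.
(* For p over F, raising p(X) to the power q^e gives p(X^(q^e)). *)
have allK (y : K) : y ^+ (q ^ e) = y.
  have [p ->] := c_surj y; rewrite -rmorphXn poly_Frobenius.
  elim/poly_ind: p => [|p a IHp]; first by rewrite comp_poly0.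
  by rewrite comp_poly_MXaddC !rmorphD !rmorphM IHp [c 'X^_]rmorphXn Xe.
have /cyclicP[g gP] : cyclic [set: {unit K}] by apply: field_unit_group_cyclic.
rewrite -(@dvdn_pred_exp q) //; last by rewrite ltn_predRL fI.1.1.
rewrite -cardK -card_finField_unit gP -orderE order_dvdn -val_eqE /=.
rewrite FinRing.val_unitX /=.
have g0 : val g != 0 by rewrite -unitfE (valP g).
by rewrite -(inj_eq (mulfI g0)) -exprS prednK // allK mulr1.
Qed.

End Residue.

(** * M-th roots of X modulo an irreducible polynomial *)

Section Bad.
Variables (F : finFieldType) (M : nat).
Hypothesis M_prime : prime M.
Hypothesis M_q : coprime M #|F|.
Implicit Types (f g p : {poly F}).
Local Notation q := #|F|.
Local Notation deg f := (size f).-1.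

Let M_gt0 : (0 < M)%N. Proof. exact: prime_gt0. Qed.
Let q_gt1 : (1 < q)%N. Proof. exact: finNzRing_gt1. Qed.
Let qe_gt0 e : (0 < q ^ e)%N. Proof. by rewrite expn_gt0 ltnW. Qed.

(** For f irreducible and different from X: the root of f is not an M-th power in
the field it generates. *)
Definition bad f :=
  (M %| (q ^ deg f).-1)%N && ~~ (f %| 'X^((q ^ deg f).-1 %/ M) - 1).

Lemma geom_sum_mod Q c : (M %| Q.-1)%N -> (0 < Q)%N ->
  (\sum_(i < c) Q ^ i = c %[mod M])%N.
Proof.
move=> M_Q Q_gt0; have Q1 : (Q = 1 %[mod M])%N.
  by apply/eqP; rewrite eqn_mod_dvd // subn1.
elim: c => [|c IHc]; first by rewrite big_ord0.
by rewrite big_ord_recr /= -modnDm IHc -modnXm Q1 modnXm exp1n modnDm addn1.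
Qed.

(** With Q = q^d and m = c d one has q^m - 1 = (Q - 1) S with
S = 1 + Q + ... + Q^(c-1), and S = c modulo M as soon as M divides Q - 1.  The
order o of X modulo f divides Q - 1, and the claim compares the conditions
o | (Q - 1) S / M and o | (Q - 1) / M. *)
Lemma bad_dvd f m : monic_irreducible_poly f -> f != 'X -> (M %| (q ^ m).-1)%N ->
  (f %| 'X^((q ^ m).-1) - 1) && ~~ (f %| 'X^((q ^ m).-1 %/ M) - 1) =
  [&& bad f, (deg f %| m)%N & ~~ (M %| m %/ deg f)%N].
Proof.
move=> fI f_X M_qm; rewrite dvdp_Xq //.
have [/dvdnP[c mE]|_] := boolP (deg f %| m)%N; last by rewrite andbF.
have d_gt0 : (0 < deg f)%N by rewrite ltn_predRL fI.1.1.
rewrite {}mE in M_qm *; rewrite mulnK //= /bad.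
have [o o_gt0 oP] := order_X fI f_X; rewrite !oP.
have o_Q : (o %| (q ^ deg f).-1)%N by rewrite -oP dvdp_Xq.
have Q_gt0 := qe_gt0 (deg f).
rewrite mulnC expnM predn_exp in M_qm *.
move: (q ^ deg f)%N o_Q Q_gt0 M_qm => Q o_Q Q_gt0 M_qm.
have [M_Q|nM_Q] := boolP (M %| Q.-1)%N; last first.
  rewrite /= Euclid_dvdM // (negPf nM_Q) /= in M_qm; case/dvdnP: M_qm => S ->.
  rewrite mulnA mulnK // dvdn_mulr //=.
have S_c := geom_sum_mod c M_Q Q_gt0.
have -> : (M %| c)%N = (M %| \sum_(i < c) Q ^ i)%N by rewrite /dvdn S_c.
move: (\sum_(i < c) _)%N => S {M_qm S_c}.
case/dvdnP: M_Q o_Q => a ->; rewrite mulnAC !mulnK //= => o_aM.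
have [/dvdnP[b ->] | nM_S] := boolP (M %| S)%N.
  by rewrite andbF mulnCA dvdn_mull.
rewrite andbT; congr (~~ _); apply/idP/idP => [o_aS|]; last exact: dvdn_mulr.
have : (o %| gcdn (a * M) (a * S))%N by rewrite dvdn_gcd o_aM.
by rewrite -muln_gcdr (eqP (_ : coprime M S)) ?muln1 // prime_coprime.
Qed.

(** In the cyclic group of units of F[X] / (f), either raising to the power M is
bijective, or M divides the order a M of the group and x^a = 1 characterizes the
M-th powers. *)
Lemma good_root f : monic_irreducible_poly f -> f != 'X -> ~~ bad f ->
  exists g, f %| g ^+ M - 'X.
Proof.
move=> fI f_X f_good; have [K [c [cardK c_surj c0]]] := residue_field fI.
have Ux : c 'X \is a GRing.unit.
  by rewrite unitfE c0; apply: ndvdp_X.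
pose x := FinRing.unit K Ux.
suff [y yM] : exists y : {unit K}, (y ^+ M)%g = x.
  have [g gE] := c_surj (val y); exists g.
  rewrite -c0 rmorphB rmorphXn subr_eq0 -gE -FinRing.val_unitX.
  by rewrite yM.
have cardU : #|[set: {unit K}]| = (q ^ deg f).-1 by rewrite card_finField_unit cardK.
have [M_Q | nM_Q] := boolP (M %| (q ^ deg f).-1)%N; last first.
  exists (x ^+ expg_invn [set: {unit K}] M)%g.
  rewrite expgAC; apply: expgK; rewrite ?inE //.
  by rewrite coprime_sym cardU prime_coprime.
have xa : (x ^+ ((q ^ deg f).-1 %/ M) = 1)%g.
  apply/eqP; rewrite -val_eqE /= FinRing.val_unitX /=.
  move: f_good; rewrite /bad M_Q negbK -c0 rmorphB rmorph1 rmorphXn /=.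
  by rewrite subr_eq0.
have /cyclicP[g gP] : cyclic [set: {unit K}] by apply: field_unit_group_cyclic.
have /cycleP[i xE] : x \in <[g]>%g by rewrite -gP inE.
move/eqP: xa; rewrite xE -expgM -order_dvdn orderE -gP cardU.
case/dvdnP: M_Q => a aM; rewrite aM mulnK // mulnC.
have a_gt0 : (0 < a)%N.
  have : (0 < #|[set: {unit K}]|)%N by apply/card_gt0P; exists 1%g; rewrite inE.
  by rewrite cardU aM muln_gt0 => /andP[].
by rewrite dvdn_pmul2r // => /dvdnP[b ->]; exists (g ^+ b)%g; rewrite expgM.
Qed.

(** Choose j with q^j >= k and q^j = 1 + b M.  In characteristic p, raising
g^M = X modulo f to the power q^j yields g^(q^j M) = X^(q^j) = X (X^b)^M modulo
f^k, and X is invertible modulo f^k. *)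
Lemma root_lift f g k : monic_irreducible_poly f -> f != 'X ->
  f %| g ^+ M - 'X -> exists h, f ^+ k %| h ^+ M - 'X.
Proof.
move=> fI f_X f_g; pose j := (k * totient M)%N.
have le_kqj : (k <= q ^ j)%N.
  rewrite (leq_trans (ltnW (ltn_expl k q_gt1))) // leq_exp2l //.
  by rewrite leq_pmulr // totient_gt0.
have [b bE] : exists b, (q ^ j = (b * M).+1)%N.
  have : (q ^ j = 1 %[mod M])%N.
    by rewrite /j mulnC expnM -modnXm Euler_exp_totient 1?coprime_sym // modnXm exp1n.
  move/eqP; rewrite eqn_mod_dvd // => /dvdnP[b bE]; exists b.
  by rewrite -bE subn1 prednK.
have /Bezout_eq1_coprimepP[[u v] /= uv1] : coprimep (f ^+ k) 'X.
  by apply: coprimep_expl; rewrite (irreducible_poly_coprime _ fI.1); apply: ndvdp_X.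
exists (g ^+ (q ^ j) * v ^+ b).
have -> : (g ^+ (q ^ j) * v ^+ b) ^+ M - 'X =
    ((g ^+ M) ^+ (q ^ j) - 'X ^+ (q ^ j)) * v ^+ (b * M)
    + 'X * ((v * 'X) ^+ (b * M) - 1).
  rewrite (exprMn _ (g ^+ _)) exprAC -(exprM v) (exprMn _ v).
  move: (_ ^+ (q ^ j)) => G; rewrite bE exprS.
  move: (_ ^+ (b * M)) ('X ^+ (b * M)) => V W.
  by rewrite mulrBl mulrBr mulr1 -mulrA [W * V]mulrC addrA subrK.
apply: dvdp_add.
  apply: dvdp_mulr; apply: dvdp_trans (dvdp_exp2l f le_kqj) _.
  have P := pchar_nat_card F j.
  rewrite -(exprNn_pchar _ P) -(exprDn_pchar _ _ P).
  exact: dvdp_exp2r.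
apply: dvdp_mull; rewrite subrX1; apply: dvdp_mulr.
by rewrite -uv1 opprD addrC addrNK dvdpNr dvdp_mull.
Qed.

(** Let g be an irreducible factor of f(X^M), of degree e, with root beta, so that
beta^M is a root of f.  From beta^(q^e - 1) = 1 one gets d | e and
(beta^M)^((q^e - 1) / M) = 1, so that M divides e / d by [bad_dvd].  Hence g has
degree at least d M, the degree of f(X^M). *)
Lemma bad_irreducible f : monic_irreducible_poly f -> f != 'X -> bad f ->
  irreducible_poly (f \Po 'X^M).
Proof.
move=> fI f_X f_bad; set h := f \Po _.
have h_monic : h \is monic.
  rewrite monicE lead_coef_comp ?size_polyXn // (eqP fI.2).
  by rewrite lead_coefXn expr1n mulr1.
have deg_h : deg h = (deg f * M)%N by rewrite size_comp_poly size_polyXn.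
have d_gt0 : (0 < deg f)%N by rewrite ltn_predRL fI.1.1.
have h_gt1 : (1 < size h)%N by rewrite -ltn_predRL deg_h muln_gt0 d_gt0.
have [g gI g_h] := irreducible_factor h_gt1.
(* With beta a root of g, both sides say that beta^M is a root of p. *)
have compE p : (g %| p \Po 'X^M) = (f %| p).
  apply/idP/idP => [g_p | f_p].
    rewrite -[_ %| _]negbK -(irreducible_poly_coprime p fI.1); apply/negP.
    move=> /Bezout_eq1_coprimepP[[u v] /= /(congr1 (fun p => p \Po 'X^M))].
    rewrite comp_polyD !comp_polyM comp_polyC => uv1.
    have : g %| 1%:P by rewrite -uv1 dvdp_add ?dvdp_mull.
    by rewrite polyC1 dvdp1 => /eqP g1; have := gI.1.1; rewrite g1.
  by rewrite (dvdp_trans g_h) // /h -(divpK f_p) comp_polyM dvdp_mull.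
have g_X : g != 'X.
  apply: contraNneq (ndvdp_X fI f_X) => gX.
  by rewrite -compE comp_polyX gX dvdp_exp // prime_gt0.
have comp1 a : f %| 'X^a - 1 = (g %| 'X^(M * a) - 1).
  by rewrite -compE rmorphB rmorph1 rmorphXn /= comp_polyX exprM.
have g_Xe : g %| 'X^((q ^ deg g).-1) - 1 by rewrite dvdp_Xq.
have [o o_gt0 oP] := order_X gI g_X.
have f_Xe : f %| 'X^((q ^ deg g).-1) - 1.
  by rewrite comp1 oP dvdn_mull // -oP.
have M_e : (M %| (q ^ deg g).-1)%N.
  have /andP[M_d _] := f_bad; apply: dvdn_trans M_d _.
  by rewrite dvdn_pred_exp // -dvdp_Xq.
have f_XeM : f %| 'X^((q ^ deg g).-1 %/ M) - 1 by rewrite comp1 mulnC divnK.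
have := bad_dvd fI f_X M_e; rewrite f_Xe f_XeM f_bad /= -dvdp_Xq // f_Xe /=.
move/esym/negbFE => M_ed.
have le_hg : (deg h <= deg g)%N.
  rewrite deg_h dvdn_leq //; first by rewrite ltn_predRL gI.1.1.
  have : (deg f %| deg g)%N by rewrite -dvdp_Xq.
  by case/dvdnP: M_ed => b /(congr1 (muln^~ (deg f))) E /divnK <-; rewrite E
    -mulnA [(M * _)%N]mulnC dvdn_mull.
have : g %= h.
  rewrite -dvdp_size_eqp // eqn_leq dvdp_leq ?monic_neq0 //=.
  by rewrite -(prednK (ltnW h_gt1)) -(prednK (ltnW gI.1.1)) ltnS.
by rewrite eqp_monic ?gI.2 // => /eqP <-; apply: gI.1.
Qed.

End Bad.

(** * Degree sums over irreducible polynomials *)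

Section IrrX.
Variables (F : finFieldType).
Implicit Types (f g p : {poly F}).
Local Notation q := #|F|.
Local Notation deg f := (size f).-1.

Definition irrX f := [&& f \is monic, `[< irreducible_poly f >] & f != 'X].

Lemma irrX_mi f : irrX f -> monic_irreducible_poly f.
Proof. by case/and3P=> ? /asboolP ? _; split. Qed.

Lemma irrX_neq f : irrX f -> f != 'X.
Proof. by case/and3P. Qed.

Lemma irrXI f : monic_irreducible_poly f -> f != 'X -> irrX f.
Proof. by move=> [? ?] ?; apply/and3P; split=> //; apply/asboolP. Qed.

Lemma deg_irrX f : irrX f -> (0 < deg f)%N.
Proof. by move=> /irrX_mi fI; rewrite ltn_predRL fI.1.1. Qed.

Lemma prod_irrX_dvd N (P : pred {poly_N F}) p :
  (forall f : {poly_N F}, P f -> irrX f) ->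
  (forall f : {poly_N F}, P f -> f %| p) ->
  (\prod_(f : {poly_N F} | P f) (f : {poly F})) %| p.
Proof.
move=> irrP Pp; elim: index_enum (index_enum_uniq {poly_N F}) => [|f s IHs].
  by rewrite big_nil dvd1p.
move=> /= /andP[s_f s_uniq]; rewrite big_cons; case: ifP => [Pf | _]; last exact: IHs.
rewrite Gauss_dvdp ?Pp ?IHs // (irreducible_poly_coprime _ (irrX_mi (irrP _ Pf)).1).
elim: s s_f {IHs s_uniq} => [|g s IHs].
  by rewrite big_nil dvdp1; have [[]] := irrX_mi (irrP _ Pf); case: (size _) => [|[]].
rewrite inE negb_or big_cons => /andP[ne_fg /IHs f_s]; case: ifP => // Pg.
rewrite -(irreducible_poly_coprime _ (irrX_mi (irrP _ Pf)).1) coprimepMr.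
rewrite !(irreducible_poly_coprime _ (irrX_mi (irrP _ Pf)).1) f_s andbT.
apply: contra ne_fg => f_g; rewrite -val_eqE /= -eqp_monic.
- apply: (irrX_mi (irrP _ Pg)).1.2 => //.
  by rewrite neq_ltn (irrX_mi (irrP _ Pf)).1.1 orbT.
- exact: (irrX_mi (irrP _ Pf)).2.
- exact: (irrX_mi (irrP _ Pg)).2.
Qed.

Lemma deg_prod_irrX N (P : pred {poly_N F}) :
  (forall f : {poly_N F}, P f -> irrX f) ->
  deg (\prod_(f : {poly_N F} | P f) (f : {poly F})) =
  (\sum_(f : {poly_N F} | P f) deg f)%N.
Proof.
move=> irrP; suff [_ //] : \prod_(f : {poly_N F} | P f) (f : {poly F}) \is monic /\
  deg (\prod_(f : {poly_N F} | P f) (f : {poly F})) =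
  (\sum_(f : {poly_N F} | P f) deg f)%N.
apply: (big_rec2 (fun (p : {poly F}) n => p \is monic /\ deg p = n)).
  by rewrite monic1 size_poly1.
move=> f p n Pf [p_monic <-].
have [f_irr f_monic] := irrX_mi (irrP _ Pf).
split; first by rewrite rpredM.
rewrite size_monicM ?monic_neq0 //.
rewrite -(prednK (ltnW f_irr.1)) -[size p]prednK ?size_poly_gt0 ?monic_neq0 //.
by rewrite addSn addnS.
Qed.

(** The polynomial X^a - 1 is separable, so it is the product of its irreducible
factors; the bound on their degrees lets them range over a finite type. *)
Lemma sum_deg_factors N a : (a%:R : F) != 0 ->
  (forall f, irrX f -> f %| 'X^a - 1 -> (deg f <= N)%N) ->
  (\sum_(f : {poly_N.+1 F} | irrX f && (f %| 'X^a - 1)%R) deg f)%N = a.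
Proof.
move=> a0 leN; rewrite -deg_prod_irrX; last by move=> f /andP[].
set P := \prod_(f | _) _.
have a_gt0 : (0 < a)%N by case: a a0 {leN P} => //; rewrite eqxx.
have sz : size ('X^a - 1 : {poly F}) = a.+1 by rewrite size_Xn_sub_1.
have p0 : 'X^a - 1 != 0 :> {poly F} by rewrite -size_poly_gt0 sz.
have P_p : P %| 'X^a - 1 by apply: prod_irrX_dvd => f /andP[].
suff : P %= 'X^a - 1 by rewrite -dvdp_size_eqp // sz => /eqP->.
have uE := divpK P_p; set u := _ %/ P in uE.
have u0 : u != 0 by apply: contraNneq p0 => u0; rewrite -uE u0 mul0r.
have P0 : P != 0 by apply: contraNneq p0 => P0; rewrite -uE P0 mulr0.
suff u1 : size u = 1%N.
  have /size_poly1P[c c0 cE] : size u == 1 by rewrite u1.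
  by rewrite -uE cE mul_polyC eqp_sym eqp_scale.
apply/eqP; rewrite eqn_leq size_poly_gt0 u0 andbT leqNgt; apply/negP => u_gt1.
have [g gI g_u] := irreducible_factor u_gt1.
have g_p : g %| 'X^a - 1 by rewrite -uE dvdp_mulr.
have g_X : g != 'X.
  apply: contraTneq g_p => ->; rewrite -[X in X %| _]subr0 dvdp_XsubCl /root !hornerE.
  by rewrite expr0n gtn_eqF // sub0r oppr_eq0 oner_neq0.
have gX := irrXI gI g_X.
have g_N : (size g <= N.+1)%N.
  by rewrite -(prednK (ltnW gI.1.1)) ltnS leN.
have g_P : g %| P.
  rewrite /P (bigD1 (npolyp N.+1 g)) /= npolypK //; first exact: dvdp_mulr.
  by rewrite gX.
have : g ^+ 2 %| 'X^a - 1 by rewrite expr2 -uE dvdp_mul.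
rewrite (separable_nosquare (separable_Xn_sub_1 a0)) //.
by rewrite neq_ltn gI.1.1 orbT.
Qed.

Lemma natr_card : (q%:R : F) = 0.
Proof.
have q_gt1 : (1 < q)%N by apply: finNzRing_gt1.
have := pnatPpi (pchar_nat_card F 1) (_ : pdiv q \in _); rewrite expn1 pi_pdiv.
by rewrite q_gt1 pchar_poly => /(_ isT) /dvdn_pcharf/(_ q)/esym; rewrite pdiv_dvd => /eqP.
Qed.

Lemma natr_pred_card m : (0 < m)%N -> ((q ^ m).-1%:R : F) = -1.
Proof.
move=> m_gt0.
have qe_gt0 : (0 < q ^ m)%N by rewrite expn_gt0 (ltnW (finNzRing_gt1 F)).
by rewrite -subn1 natrB // natrX natr_card expr0n gtn_eqF // sub0r.
Qed.

Lemma sum_deg_all N m : (0 < m <= N)%N ->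
  (\sum_(f : {poly_N.+1 F} | irrX f && (deg f %| m)) deg f = (q ^ m).-1)%N.
Proof.
move=> /andP[m_gt0 le_mN].
have dvdE f : irrX f -> (f %| 'X^((q ^ m).-1) - 1) = (deg f %| m)%N.
  by move=> fX; rewrite dvdp_Xq ?irrX_neq //; apply: irrX_mi.
rewrite -[RHS](@sum_deg_factors N); last 1 first.
- by move=> f fX; rewrite dvdE // => /(dvdn_leq m_gt0)/leq_trans; apply.
- by apply: eq_bigl => f; case: (boolP (irrX f)) => //= fX; rewrite dvdE.
- by rewrite natr_pred_card // oppr_eq0 oner_neq0.
Qed.

Variable M : nat.
Hypothesis M_prime : prime M.

Let M_gt0 : (0 < M)%N. Proof. exact: prime_gt0. Qed.

(** If M divides q^m - 1, these are by [bad_dvd] the irreducible factors of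
X^(q^m - 1) - 1 that do not divide X^((q^m - 1) / M) - 1; otherwise no bad f has
a degree dividing m. *)
Lemma sum_deg_bad_new N m : (0 < m <= N)%N ->
  (\sum_(f : {poly_N.+1 F} |
      irrX f && [&& bad M f, deg f %| m & ~~ (M %| m %/ deg f)]) deg f
   = if (M %| (q ^ m).-1) then (q ^ m).-1 %/ M * M.-1 else 0)%N.
Proof.
move=> /andP[m_gt0 le_mN]; case: ifP => [M_qm | nM_qm]; last first.
  rewrite big1 // => f /and4P[fX /andP[M_d _] d_m _]; move: nM_qm.
  by rewrite (dvdn_trans M_d) // dvdn_pred_exp ?finNzRing_gt1 ?deg_irrX.
have dvdE f : irrX f -> (f %| 'X^((q ^ m).-1) - 1) = (deg f %| m)%N.
  by move=> fX; rewrite dvdp_Xq ?irrX_neq //; apply: irrX_mi.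
have a_qm : 'X^((q ^ m).-1 %/ M) - 1 %| ('X^((q ^ m).-1) - 1 : {poly F}).
  by rewrite -[X in _ %| 'X^X - 1](divnK M_qm) exprM (subrX1 _ M) dvdp_mulr.
have a0 : (((q ^ m).-1 %/ M)%:R : F) != 0.
  have := natr_pred_card m_gt0; rewrite -{1}(divnK M_qm) natrM => /eqP.
  by apply: contraTneq => ->; rewrite mul0r eq_sym oppr_eq0 oner_neq0.
have leN f : irrX f -> f %| 'X^((q ^ m).-1 %/ M) - 1 -> (deg f <= N)%N.
  move=> fX /dvdp_trans/(_ a_qm); rewrite dvdE //.
  by move=> /(dvdn_leq m_gt0)/leq_trans; apply.
apply/eqP; rewrite -(eqn_add2l ((q ^ m).-1 %/ M)%N); apply/eqP.
rewrite -mulnS prednK // divnK //.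
rewrite -[RHS](@sum_deg_all N) ?m_gt0 // -{1}(sum_deg_factors a0 leN).
rewrite [RHS](bigID (fun f : {poly_N.+1 F} =>
  (f : {poly F}) %| 'X^((q ^ m).-1 %/ M) - 1)) /=.
congr (_ + _)%N; apply: eq_bigl => f; case: (boolP (irrX f)) => //= fX.
  rewrite -dvdE //; case: (boolP (_ %| 'X^(_ %/ _) - 1)); rewrite ?andbF ?andbT //.
  by move/dvdp_trans/(_ a_qm) => ->.
by rewrite -bad_dvd ?irrX_neq // ?dvdE //; apply: irrX_mi.
Qed.

Definition sum_deg_bad N m :=
  (\sum_(f : {poly_N.+1 F} | [&& irrX f, bad M f & deg f %| m]) deg f)%N.

(** For M | m, the remaining bad f, those with M | m / deg f, are the ones whose
degree divides m / M. *)
Lemma sum_deg_bad_rec N m : (0 < m <= N)%N ->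
  sum_deg_bad N m = ((if (M %| (q ^ m).-1) then (q ^ m).-1 %/ M * M.-1 else 0) +
    (if M %| m then sum_deg_bad N (m %/ M) else 0))%N.
Proof.
move=> m_N; rewrite -(sum_deg_bad_new m_N) /sum_deg_bad.
rewrite (bigID (fun f : {poly_N.+1 F} => (M %| m %/ deg f)%N)) /= addnC; congr (_ + _)%N.
  by apply: eq_bigl => f; rewrite -!andbA.
have dvd_swap d e : (d %| m)%N && (e %| m %/ d)%N = (e * d %| m)%N.
  have [d_m | nd_m] /= := boolP (d %| m)%N; first by rewrite dvdn_divRL.
  by apply/esym; apply: contraNF nd_m; apply/dvdn_trans/dvdn_mull.
case: ifP => [M_m | nM_m].
  apply: eq_bigl => f; rewrite -!andbA dvd_swap mulnC -dvd_swap M_m.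
  by case: (irrX f).
rewrite big1 // => f /andP[/and3P[_ _ d_m] M_md].
by have := dvd_swap (deg f) M; rewrite d_m M_md mulnC -dvd_swap nM_m.
Qed.

End IrrX.

(** * The identity of logarithmic derivatives *)

Section Identity.
Variables (F : finFieldType) (M t : nat) (qM : {unit 'Z_M}).
Local Notation q := #|F|.
Local Notation deg f := (size f).-1.
Hypothesis M_prime : prime M.
Hypotheses (qME : val qM = q%:R) (tE : t = #[qM]%g).

Let M_gt0 : (0 < M)%N. Proof. exact: prime_gt0. Qed.
Let t_gt0 : (0 < t)%N. Proof. by rewrite tE order_gt0. Qed.
Let qe_gt0 e : (0 < q ^ e)%N.
Proof. by rewrite expn_gt0 (ltnW (finNzRing_gt1 F)). Qed.

Lemma dvdn_order m : (t %| m)%N = (M %| (q ^ m).-1)%N.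
Proof.
rewrite tE order_dvdn -val_eqE /= FinRing.val_unitX qME -natrX.
have M_gt1 := prime_gt1 M_prime.
rewrite -subn1 -eqn_mod_dvd // -(val_Zp_nat M_gt1) -(val_Zp_nat M_gt1).
by rewrite val_eqE.
Qed.

(** The multiplicities of the blocks (f, k) of an M-th power are the multiples of
this number. *)
Definition mult_step (f : {poly F}) := if bad M f then M else 1%N.

(** The number of elements of the multiplicative group of the field with q^m
elements that are not M-th powers. *)
Definition nb_nonpowers m := (if (M %| (q ^ m).-1) then (q ^ m).-1 %/ M * M.-1 else 0)%N.

(** The recurrence [sum_deg_bad_rec] unfolded along m / M, m / M^2, ...; the cut-off
K is harmless since M^k > m for k > m. *)
Lemma sum_nb_nonpowers N m K : (0 < m <= N)%N -> (m <= K)%N ->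
  (\sum_(1 <= k < K.+1 | M ^ k %| m) nb_nonpowers (m %/ M ^ k) =
   if M %| m then sum_deg_bad F M N (m %/ M) else 0)%N.
Proof.
elim/ltn_ind: m K => m IHm K /andP[m_gt0 le_mN] le_mK.
case: ifP => [M_m | nM_m]; last first.
  rewrite big_nat_cond big1 // => k /andP[/andP[k_gt0 _] Mk_m]; case/negP: nM_m.
  by rewrite (dvdn_trans _ Mk_m) // -(prednK k_gt0) expnS dvdn_mulr.
have lt_m : (m %/ M < m)%N by rewrite ltn_Pdiv ?prime_gt1.
have m'_gt0 : (0 < m %/ M)%N by rewrite divn_gt0 // dvdn_leq.
rewrite sum_deg_bad_rec //; last by rewrite m'_gt0 (leq_trans (leq_div _ _)).
case: K le_mK => [|K] le_mK; first by have := leq_trans m_gt0 le_mK.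
rewrite big_ltn_cond // expn1 M_m -/(nb_nonpowers _); congr (_ + _)%N.
have m'_N : (0 < m %/ M <= N)%N by rewrite m'_gt0 (leq_trans (leq_div _ _)).
have le_m'K : (m %/ M <= K)%N by rewrite -ltnS (leq_trans lt_m).
rewrite -(IHm _ lt_m K m'_N le_m'K).
rewrite big_add1 /=; apply: congr_big_nat => // k /andP[k_gt0 _].
  by rewrite expnS dvdn_divRL // mulnC.
by rewrite expnS divnMA.
Qed.

Lemma nb_nonpowersR m : (nb_nonpowers m)%:R =
  if (t %| m)%N then ((q ^ m)%:R - 1) * (M%:R - 1) / M%:R else 0 :> rat.
Proof.
rewrite dvdn_order /nb_nonpowers; case: ifP => // /dvdnP[a aE]; rewrite aE mulnK //.
have -> : (q ^ m)%:R = (a * M)%:R + 1 :> rat by rewrite -aE natr1 prednK.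
rewrite !natrM.
have -> : M%:R = M.-1%:R + 1 :> rat by rewrite natr1 prednK.
have M0 : M.-1%:R + 1 != 0 :> rat by rewrite natr1 prednK // pnatr_eq0 -lt0n.
by field.
Qed.

(** Bad polynomials of degree d contribute d M if d M | m, instead of d if d | m.
With S(m) the sum of the bad degrees dividing m, this changes the total
q^m - 1 by M S(m / M) - S(m) = (M - 1) S(m / M) - nb_nonpowers m, where
S(m / M) = 0 if M does not divide m. *)
Lemma sum_mult_step N m : (0 < m <= N)%N ->
  (\sum_(f : {poly_N.+1 F} | irrX f && (deg f * mult_step f %| m))
     deg f * mult_step f)%N%:R =
  (q ^ m)%:R - 1 - (nb_nonpowers m)%:R +
  \sum_(1 <= k < m.+1 | (M ^ k %| m)%N)
     (M%:R - 1) * (nb_nonpowers (m %/ M ^ k))%:R :> rat.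
Proof.
move=> m_N; have /andP[m_gt0 _] := m_N.
rewrite -mulr_sumr -natr_sum (sum_nb_nonpowers m_N) //.
rewrite (bigID (fun f : {poly_N.+1 F} => bad M f)) /= natrD.
have -> : (\sum_(f : {poly_N.+1 F} | irrX f && (deg f * mult_step f %| m) && bad M f)
    deg f * mult_step f = M * (if M %| m then sum_deg_bad F M N (m %/ M) else 0))%N.
  rewrite /sum_deg_bad; case: ifP => [M_m | nM_m]; last first.
    rewrite big1 ?muln0 // => f /andP[/andP[_]]; rewrite /mult_step => + b_f.
    by rewrite b_f => /(dvdn_trans (dvdn_mull _ (dvdnn _))); rewrite nM_m.
  rewrite big_distrr /=; apply: eq_big => [f | f /andP[_ b_f]]; last first.
    by rewrite /mult_step b_f mulnC.
  by rewrite /mult_step; case: ifP => _; rewrite ?andbF //= andbT dvdn_divRL.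
have -> : (\sum_(f : {poly_N.+1 F} | irrX f && (deg f * mult_step f %| m) && ~~ bad M f)
    deg f * mult_step f =
  \sum_(f : {poly_N.+1 F} | irrX f && (deg f %| m) && ~~ bad M f) deg f)%N.
  apply: eq_big => [f | f /andP[_ /negPf b_f]]; last by rewrite /mult_step b_f muln1.
  by rewrite /mult_step; case: ifP => //=; rewrite ?andbF // muln1.
have := sum_deg_all F m_N; rewrite (bigID (fun f : {poly_N.+1 F} => bad M f)) /=.
rewrite (eq_bigl (fun f : {poly_N.+1 F} =>
  [&& irrX f, bad M f & deg f %| m]%N)); last first.
  by move=> f; rewrite -andbA [(_ %| _)%N && _]andbC.
rewrite -/(sum_deg_bad F M N m) sum_deg_bad_rec // -/(nb_nonpowers m).
move=> /(congr1 (fun n => n.+1)).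
rewrite prednK // => <-; rewrite -!natr1 !natrD natrM.
ring.
Qed.

(** The coefficient of u^m in the logarithmic derivative of c(s, u^w). *)
Definition dlog_coef (s w m : nat) : rat :=
  if (w %| m)%N then w%:R * ((s ^ (m %/ w))%:R - 1) else 0.

(** The case j = 1 of the theorem, coefficient by coefficient: the k-th inner factor
contributes (M - 1) nb_nonpowers (m / M^k) when M^k | m. *)
Lemma dlog_identity N m K : (0 < m <= N)%N -> (m <= K)%N ->
  dlog_coef q 1 m + (1 - M%:R) / (M * t)%:R * dlog_coef (q ^ t) t m
  + \sum_(1 <= k < K.+1)
      (1 - M%:R) ^+ 2 / (M ^ k.+1 * t)%:R * dlog_coef (q ^ t) (M ^ k * t) m
  = (\sum_(f : {poly_N.+1 F} | irrX f && (deg f * mult_step f %| m))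
       deg f * mult_step f)%N%:R.
Proof.
move=> m_N le_mK; rewrite sum_mult_step //.
have M0 : M%:R != 0 :> rat by rewrite pnatr_eq0 -lt0n.
have t0 : t%:R != 0 :> rat by rewrite pnatr_eq0 -lt0n.
congr (_ + _ + _).
- by rewrite /dlog_coef dvd1n divn1 mul1r.
- rewrite nb_nonpowersR /dlog_coef; case: ifP => [t_m|_]; last by rewrite mulr0 oppr0.
  rewrite -expnM [(t * _)%N]mulnC divnK // natrM.
  by field; rewrite M0 t0.
rewrite (@big_cat_nat _ _ _ m.+1) //= addrC big_nat_cond big1 ?add0r => [|k]; last first.
  case/andP=> /andP[lt_mk _] _; rewrite /dlog_coef ifN ?mulr0 //.
  apply/negP => /dvdn_leq; have /andP[m_gt0 _] := m_N => /(_ m_gt0).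
  rewrite leqNgt (leq_trans (ltn_trans lt_mk (ltn_expl k (prime_gt1 M_prime)))) //.
  by rewrite leq_pmulr.
rewrite [RHS]big_mkcond /=; apply: eq_bigr => k _.
rewrite nb_nonpowersR /dlog_coef.
have -> : (M ^ k * t %| m)%N = (M ^ k %| m)%N && (t %| m %/ M ^ k)%N.
  have [Mk_m | nMk_m] /= := boolP (M ^ k %| m)%N; first by rewrite dvdn_divRL // mulnC.
  by apply: contraNF nMk_m; apply/dvdn_trans/dvdn_mulr.
case: (boolP (M ^ k %| m)%N) => //= Mk_m; last by rewrite mulr0.
case: ifP => t_m; last by rewrite !mulr0.
rewrite divnMA -expnM [(t * _)%N]mulnC divnK //.
rewrite !natrM expnS natrM.
have Mk0 : (M ^ k)%:R != 0 :> rat by rewrite pnatr_eq0 -lt0n expn_gt0 M_gt0.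
by field; rewrite M0 t0 Mk0.
Qed.

End Identity.

(** * The outer factors as products over irreducible polynomials *)

Section Series.
Variables (F : finFieldType) (M t : nat) (qM : {unit 'Z_M}).
Local Notation q := #|F|.
Local Notation deg f := (size f).-1.
Hypothesis M_prime : prime M.
Hypotheses (qME : val qM = q%:R) (tE : t = #[qM]%g).

Let M_gt0 : (0 < M)%N. Proof. exact: prime_gt0. Qed.
Let t_gt0 : (0 < t)%N. Proof. by rewrite tE order_gt0. Qed.

Definition cfac (s w : nat) : fps := fps_substX w (cser s%:R).

Definition inner_factor (j k : nat) : fps :=
  fps_rpow (cfac (q ^ t)%N (M ^ k * t * j)%N)
    ((1 - M%:R) ^+ 2 / (M ^ k.+1 * t)%:R).

Definition outer_factor (j : nat) : fps :=
  cfac q j * fps_rpow (cfac (q ^ t)%N (t * j)%N) ((1 - M%:R) / (M * t)%:R)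
  * infprod (inner_factor j).

Lemma cfac0 s w : cfac s w 0%N = 1.
Proof. by rewrite substX0 cser0. Qed.

Lemma is_dlog_cfac s w : (0 < w)%N -> is_dlog (cfac s w) (FPS (dlog_coef s w)).
Proof.
move=> w_gt0; have := is_dlog_substX w_gt0 (is_dlog_cser s%:R).
congr (is_dlog _ _); apply: fpsP => n; rewrite fpsC_mul /= /dlog_coef.
by case: ifP; rewrite ?mulr0 // expr1n natrX.
Qed.

Lemma is_dlog_geomX w : (0 < w)%N ->
  is_dlog (geomX w) (FPS (fun n => if (0 < n)%N && (w %| n)%N then w%:R else 0)).
Proof.
move=> w_gt0; have := is_dlog_substX w_gt0 (is_dlog_geo_series 1).
congr (is_dlog _ _); apply: fpsP => n; rewrite fpsC_mul /=.
case: ifP => [w_n | _]; last by rewrite andbF mulr0.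
rewrite andbT expr1n; case: posnP => [-> | n_gt0].
  by rewrite div0n /= subrr mulr0.
by rewrite gtn_eqF /= ?subr0 ?mulr1 // divn_gt0 // dvdn_leq.
Qed.

Lemma inner_eqm w j k : (0 < j)%N -> (w <= M ^ k * t * j)%N ->
  eqm w.-1 (inner_factor j k) 1.
Proof.
move=> j_gt0 le_w; apply: eqm_rpow; apply: (@eqmW (M ^ k * t * j).-1).
  by rewrite -!subn1 leq_sub2r.
by apply: eqm_substX; rewrite cser0.
Qed.

Lemma inner_tail j k : (0 < j)%N -> eqm k.-1 (inner_factor j k) 1.
Proof.
move=> j_gt0; apply: inner_eqm => //.
rewrite (leq_trans (ltnW (ltn_expl k (prime_gt1 M_prime)))) //.
by rewrite -mulnA leq_pmulr // muln_gt0 t_gt0.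
Qed.

Lemma outer_tail j : (0 < j)%N -> eqm j.-1 (outer_factor j) 1.
Proof.
move=> j_gt0; rewrite -(mulr1 1) -[X in X * 1](mulr1 1); apply: eqmM.
  apply: eqmM; first by apply: eqm_substX; rewrite cser0.
  apply: eqm_rpow; apply: (@eqmW (t * j).-1).
    by rewrite -!subn1 leq_sub2r // leq_pmull.
  by apply: eqm_substX; rewrite cser0.
apply: (@eqm_trans _ _ (\prod_(1 <= k < j.-1.+1) inner_factor j k)).
  by apply: infprod_eqm => k _; apply: inner_tail.
have : eqm j.-1 (\prod_(1 <= k < j.-1.+1) inner_factor j k)
    (\prod_(1 <= k < j.-1.+1) 1).
  apply: eqm_prod => k _; apply: inner_eqm => //.
  by rewrite leq_pmull // muln_gt0 expn_gt0 M_gt0.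
by rewrite big1_eq.
Qed.

Lemma prod_coef0 (I : Type) (r : seq I) (P : pred I) (G : I -> fps) :
  (forall i, P i -> G i 0%N = 1) -> (\prod_(i <- r | P i) G i) 0%N = 1.
Proof.
by move=> G0; elim/big_rec: _ => // i f Pi f0; rewrite fpsM0 G0 // f0 mulr1.
Qed.

(** Both logarithmic derivatives are supported on the multiples of j, where they are
j times those of the case j = 1. *)
Lemma outer_factorE N n j : (0 < j)%N -> (n <= N)%N ->
  eqm n (outer_factor j)
    (\prod_(f : {poly_N.+1 F} | irrX f) geomX (j * (deg f * mult_step M f))).
Proof.
move=> j_gt0 le_nN.
(* A has a logarithmic derivative, and agrees with the outer factor up to u^n. *)
pose A := cfac q j * fps_rpow (cfac (q ^ t)%N (t * j)%N) ((1 - M%:R) / (M * t)%:R)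
  * \prod_(1 <= k < n.+1) inner_factor j k.
apply: (@eqm_trans _ _ A).
  by apply: eqmM => //; apply: infprod_eqm => k _; apply: inner_tail.
have tj_gt0 : (0 < t * j)%N by rewrite muln_gt0 t_gt0.
have Mtj_gt0 k : (0 < M ^ k * t * j)%N by rewrite -mulnA muln_gt0 expn_gt0 M_gt0.
have w_gt0 (f : {poly_N.+1 F}) : irrX f -> (0 < j * (deg f * mult_step M f))%N.
  move=> fX; rewrite !muln_gt0 j_gt0 deg_irrX //= /mult_step.
  by case: ifP.
have A0 : A 0%N = 1.
  rewrite !fpsM0 cfac0 rpow0 !mul1r; apply: prod_coef0 => k _; exact: rpow0.
have B0 : (\prod_(f : {poly_N.+1 F} | irrX f)
    geomX (j * (deg f * mult_step M f))) 0%N = 1.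
  by apply: prod_coef0 => f _; rewrite coef_geomX dvdn0.
have dI k : is_dlog (inner_factor j k) (fpsC ((1 - M%:R) ^+ 2 / (M ^ k.+1 * t)%:R)
    * FPS (dlog_coef (q ^ t)%N (M ^ k * t * j)%N)).
  by apply: is_dlog_rpow; [apply: cfac0 | apply: is_dlog_cfac].
have dA := is_dlogM (is_dlogM (is_dlog_cfac q j_gt0)
    (is_dlog_rpow ((1 - M%:R) / (M * t)%:R) (cfac0 _ _) (is_dlog_cfac (q ^ t)%N tj_gt0)))
  (@is_dlog_prod _ (index_iota 1 n.+1) predT _ _ (fun k _ => dI k)).
have dB := @is_dlog_prod _ (index_enum {poly_N.+1 F}) _ _ _
  (fun f fX => is_dlog_geomX (w_gt0 f fX)).
apply: (dlog_eqm A0 B0 dA dB) => m le_mn.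
rewrite !coef_fpsD fpsC_mul !fps_sum.
under eq_bigr do rewrite fpsC_mul.
rewrite /=.
have dlog_coefM s w : dlog_coef s (w * j) m =
    if (j %| m)%N then j%:R * dlog_coef s w (m %/ j) else 0.
  rewrite /dlog_coef; case: (boolP (j %| m)%N) => [j_m | nj_m].
    rewrite dvdn_divRL //; case: (w * j %| m)%N; last by rewrite mulr0.
    by rewrite -divnMA [(j * w)%N]mulnC natrM -mulrA mulrCA.
  by rewrite ifN //; apply: contraNN nj_m; apply/dvdn_trans/dvdn_mull.
have := dlog_coefM q 1%N; rewrite mul1n => ->; rewrite dlog_coefM.
under eq_bigr do rewrite dlog_coefM.
have [-> | m_gt0] := posnP m.
  rewrite dvdn0 div0n !big1 => [||k _];
    by rewrite /dlog_coef ?dvdn0 ?div0n ?expn0 ?subrr ?mulr0 ?addr0.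
case: (boolP (j %| m)%N) => [j_m | nj_m]; last first.
  rewrite !mulr0 !big1 ?addr0 // => [f fX|k _]; last by rewrite mulr0.
  by rewrite ifN //; apply: contraNN nj_m => /andP[_]; apply/dvdn_trans/dvdn_mulr.
have m'_N : (0 < m %/ j <= N)%N.
  rewrite (leq_trans (leq_div m j) (leq_trans le_mn le_nN)) andbT.
  by rewrite divn_gt0 // dvdn_leq.
have le_m'n : (m %/ j <= n)%N by rewrite (leq_trans (leq_div _ _)).
transitivity (j%:R * (\sum_(f : {poly_N.+1 F} |
    irrX f && (deg f * mult_step M f %| m %/ j)) deg f * mult_step M f)%N%:R : rat).
  rewrite -(dlog_identity M_prime qME tE m'_N le_m'n) !mulrDr mulr_sumr.
  congr (_ + _ + _); first by rewrite mulrCA.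
  by apply: eq_bigr => k _; rewrite mulrCA.
rewrite natr_sum mulr_sumr [LHS]big_mkcondr /=; apply: eq_bigr => f fX.
by rewrite dvdn_divRL // [(_ * j)%N]mulnC [in RHS]natrM.
Qed.

End Series.

(** * Counting the classes of powers *)

Lemma card_imset_eq (T U V : finType) (f : T -> U) (g : T -> V) (A : {set T}) :
  {in A &, forall x y, (f x == f y) = (g x == g y)} -> #|f @: A| = #|g @: A|.
Proof.
move=> fg; have [-> | [x0 x0A]] := set_0Vmem A; first by rewrite !imset0 !cards0.
pose r u := odflt x0 [pick x in A | f x == u].
have rP x : x \in A -> r (f x) \in A /\ f (r (f x)) = f x.
  move=> xA; rewrite /r; case: pickP => [y /andP[yA /eqP] //|/(_ x)].
  by rewrite xA eqxx.
have -> : g @: A = (fun u => g (r u)) @: (f @: A).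
  apply/setP => v; apply/imsetP/imsetP => [[x xA ->] | [_ /imsetP[x xA ->] ->]].
    exists (f x); first exact: imset_f.
    by have [rA /eqP rf] := rP x xA; apply/esym/eqP; rewrite -fg.
  by exists (r (f x)) => //; case: (rP x xA).
rewrite [RHS]card_in_imset // => _ _ /imsetP[x xA ->] /imsetP[y yA ->] /eqP.
have [[rxA rx] [ryA ry]] := (rP x xA, rP y yA).
by rewrite -fg // rx ry => /eqP.
Qed.

Lemma sum_count (I : finType) (s : seq I) (w : I -> nat) :
  (\sum_(i <- s) w i = \sum_i count_mem i s * w i)%N.
Proof.
elim: s => [|a s IHs]; first by rewrite big_nil big1.
rewrite big_cons IHs /=; under [RHS]eq_bigr do rewrite mulnDl.
rewrite big_split /=; congr (_ + _)%N.
rewrite (bigD1 a) //= eqxx mul1n big1 ?addn0 // => i /negPf.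
by rewrite eq_sym => ->.
Qed.

Section Classes.
Variables (F : finFieldType) (M n' : nat).
Hypothesis M_prime : prime M.
Local Notation n := n'.+1.
Local Notation deg f := (size f).-1.
Local Notation GL := {'GL_n[F]}.

Lemma mult_bound m (A : 'M[F]_m) f k : monic_irreducible_poly f -> (0 < k)%N ->
  (mult A f k * (deg f * k) <= m)%N.
Proof.
move=> fI k_gt0; have [s s_prim sA] := primary_form A.
rewrite (mult_bdiag sA) // (mxsim_size sA) bsizeE.
rewrite (perm_big _ (perm_nseq_filter s (f, k))).
by rewrite big_cat big_nseq iter_addn_0 /= [(count_mem _ _ * _)%N]mulnC leq_addr.
Qed.

Lemma mpow_GL (x : GL) : mpow M (val x) <-> exists y : GL, (y ^+ M)%g = x.
Proof.
have M_gt0 := prime_gt0 M_prime.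
split=> [[B BM] | [y <-]]; last first.
  by exists (val y); rewrite mxev_exp mxevX -FinRing.val_unitX.
have UB : (B : 'M[F]_n) \is a GRing.unit.
  by rewrite -(unitrX_pos _ M_gt0) -{1}[B]mxevX -mxev_exp BM; apply: valP.
exists (FinRing.unit _ UB : GL); apply: val_inj.
by rewrite FinRing.val_unitX /= -BM mxev_exp mxevX.
Qed.

Lemma class_mxsim (x y : GL) :
  (x ^: 'GL_n[F] = y ^: 'GL_n[F])%g <-> mxsim (val x) (val y).
Proof.
split=> [/class_eqP/imsetP[g _ ->] | [P [Q [PQ QP xP]]]].
  exists (val g^-1)%g, (val g); split.
  - by rewrite mulmxE -[LHS]/(val (g^-1 * g)%g) mulVg.
  - by rewrite mulmxE -[LHS]/(val (g * g^-1)%g) mulgV.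
  - by rewrite !mulmxE -[LHS]/(val (y ^ g * g^-1)%g) conjgE mulgA mulgK.
have UP : P \in unitmx by have [] := mulmx1_unit PQ.
pose g : GL := FinRing.unit _ UP.
apply/class_eqP/imsetP; exists g^-1%g; first by rewrite inE.
rewrite conjgE invgK; apply: (mulIg g); rewrite -!mulgA mulVg mulg1.
by apply: val_inj; rewrite /= -!mulmxE xP.
Qed.

Definition mpow_set : {set GL} := [set x : GL | `[< mpow M (val x) >]].

Lemma nb_power_classesE :
  nb_power_classes F n M = #|[set (x ^: 'GL_n[F])%g | x in mpow_set]|.
Proof.
rewrite /nb_power_classes; congr #|pred_of_set _|; apply/setP => C; rewrite inE.
apply/andP/imsetP => [[/imsetP[x _ ->] /subsetP sxM] | [x]].
  exists x => //; rewrite inE; apply/asboolP/mpow_GL.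
  by have /imsetP[y _ ->] := sxM x (class_refl _ _); exists y.
rewrite inE => /asboolP/mpow_GL[y yx] ->; split; first by rewrite mem_classes ?inE.
apply/subsetP => _ /imsetP[g _ ->]; apply/imsetP; exists (y ^ g)%g; rewrite ?inE //.
by rewrite -yx conjXg.
Qed.

(** The pairs (f, k) with deg f <= n and k <= n, among which all the blocks of an
n x n matrix are found. *)
Definition block_index : finType := ({poly_n.+1 F} * 'I_n.+1)%type.
Definition valid (i : block_index) := irrX (i.1 : {poly F}) && (0 < i.2)%N.
Definition block_dim (i : block_index) := (deg i.1 * i.2)%N.
Definition block_of (i : block_index) : {poly F} * nat := (i.1 : {poly F}, i.2 : nat).

Lemma block_of_inj : injective block_of.
Proof. by move=> [f k] [g l] [/val_inj -> /val_inj ->]. Qed.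

Definition mults (x : GL) : {ffun block_index -> 'I_n.+1} :=
  [ffun i => if valid i then inord (mult (val x) i.1 i.2) else ord0].

Lemma multsE x i : valid i -> mults x i = mult (val x) i.1 i.2 :> nat.
Proof.
move=> Vi; rewrite ffunE Vi inordK // ltnS; have /andP[iX i_gt0] := Vi.
apply: leq_trans (mult_bound (val x) (irrX_mi iX) i_gt0).
by rewrite leq_pmulr // muln_gt0 deg_irrX.
Qed.

Lemma mults_eq x y : (mults x == mults y) = (x ^: 'GL_n[F] == y ^: 'GL_n[F])%g.
Proof.
apply/eqP/eqP => [eq_xy | /class_mxsim sxy]; last first.
  by apply/ffunP => i; rewrite !ffunE (mult_sim _ _ sxy).
apply/class_mxsim/mxsim_mult => f k fI k_gt0.
have [-> | f_X] := eqVneq f 'X; first by rewrite !mult_unit // GL_unitmx.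
have [le_n | gt_n] := leqP (deg f * k) n; last first.
  suff m0 (z : GL) : mult (val z) f k = 0%N by rewrite !m0.
  have := mult_bound (val z) fI k_gt0; case: (mult _ _ _) => // a.
  by rewrite leqNgt mulSn ltn_addr.
have d_gt0 : (0 < deg f)%N by rewrite ltn_predRL fI.1.1.
have f_n : (size f <= n.+1)%N.
  by rewrite -(prednK (ltnW fI.1.1)) ltnS (leq_trans _ le_n) // leq_pmulr.
have k_n : (k < n.+1)%N by rewrite ltnS (leq_trans _ le_n) // leq_pmull.
pose i : block_index := (npolyp n.+1 f, Ordinal k_n).
have Vi : valid i by rewrite /valid /= npolypK // irrXI.
by have := multsE x Vi; rewrite eq_xy multsE //= npolypK.
Qed.

Definition mult_family : {set {ffun block_index -> 'I_n.+1}} :=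
  [set m : {ffun block_index -> 'I_n.+1} |
    [forall i, if valid i then (mult_step M i.1 %| m i)%N else m i == ord0]
    && (\sum_i m i * block_dim i == n)%N].

Lemma mults_mem x : x \in mpow_set -> mults x \in mult_family.
Proof.
rewrite inE => /asboolP[B BM]; rewrite inE; apply/andP; split.
  apply/forallP => i; case: ifP => Vi; last by rewrite ffunE Vi.
  rewrite multsE // /mult_step; case: ifP => // bad_i.
  have /andP[iX i_gt0] := Vi; rewrite -BM mult_mpow ?dvdn_mulr //.
  - exact: prime_gt0.
  - exact: irrX_mi.
  - by apply: bad_irreducible => //; [apply: irrX_mi | apply: irrX_neq].
have [s s_prim sx] := primary_form (val x).
have s_size : (\sum_(y <- s) deg y.1 * y.2 = n)%N by rewrite -bsizeE -(mxsim_size sx).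
have s_emb y : y \in s -> exists2 i, valid i & y = block_of i.
  move=> s_y; have [y_monic y_irr y_gt0] := s_prim y s_y.
  have yI : monic_irreducible_poly y.1 by [].
  (* A block at X would make x singular. *)
  have y_X : y.1 != 'X.
    apply: contraTneq s_y => yX; rewrite -has_pred1 has_count.
    have <- : mult (val x) 'X y.2 = count_mem y s.
      by rewrite (mult_bdiag sx) // -yX -?surjective_pairing.
    by rewrite mult_unit // GL_unitmx.
  have le_n : (deg y.1 * y.2 <= n)%N by rewrite -s_size (big_rem y) //= leq_addr.
  have d_gt0 : (0 < deg y.1)%N by rewrite ltn_predRL yI.1.1.
  have f_n : (size y.1 <= n.+1)%N.
    by rewrite -(prednK (ltnW yI.1.1)) ltnS (leq_trans _ le_n) // leq_pmulr.
  have k_n : (y.2 < n.+1)%N by rewrite ltnS (leq_trans _ le_n) // leq_pmull.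
  exists (npolyp n.+1 y.1, Ordinal k_n : 'I_n.+1); last first.
    by rewrite /block_of /= npolypK // -surjective_pairing.
  by rewrite /valid /= npolypK // irrXI.
have [s' s'V sE] : exists2 s', all valid s' & s = map block_of s'.
  elim: (s) s_emb => [|y u IHu] u_emb; first by exists [::].
  have [|u' u'V ->] := IHu; first by move=> z z_u; apply: u_emb; rewrite inE z_u orbT.
  by have [|i Vi ->] := u_emb y; [apply: mem_head | exists (i :: u'); rewrite //= Vi].
apply/eqP; rewrite -[RHS]s_size sE big_map [RHS]sum_count; apply: eq_bigr => i _.
case: (boolP (valid i)) => [Vi | nVi]; last first.
  rewrite ffunE (negPf nVi) (count_memPn _) ?mul0n //.
  by apply: contra nVi => /(allP s'V).
congr (_ * _)%N; rewrite multsE //; have /andP[iX i_gt0] := Vi.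
rewrite (mult_bdiag sx) //; last exact: irrX_mi.
rewrite sE count_map; apply: eq_count => k /=.
by rewrite -[(_, _)]/(block_of i) (inj_eq block_of_inj).
Qed.

End Classes.

Section Count.
Variables (F : finFieldType) (M n' : nat).
Hypotheses (M_prime : prime M) (M_q : coprime M #|F|).
Local Notation n := n'.+1.
Local Notation deg f := (size f).-1.
Local Notation GL := {'GL_n[F]}.

Lemma mpow_primary f k c : irrX (f : {poly F}) -> (0 < k)%N -> (mult_step M f %| c)%N ->
  mpow M (bdiag (nseq c (f, k))).
Proof.
move=> fX k_gt0 /dvdnP[b ->]; apply: mpow_nseq; have fI := irrX_mi fX.
have f_X := irrX_neq fX; rewrite /mult_step; case: ifP => [f_bad | /negbT f_good].
  by apply: mpow_bad => //; [apply: prime_gt0 | apply: bad_irreducible].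
have [g f_g] := good_root M_prime fI f_X f_good.
apply: mpow_good.
- exact: (root_lift M_prime M_q k fI f_X f_g).
- by apply: monic_exp; case: fI.
- by rewrite -ltn_predRL size_exp muln_gt0 deg_irrX.
Qed.

(** The block diagonal matrix with the prescribed multiplicities has size n only up
to a provable equality, whence the cast. *)
Lemma mults_surj (m : {ffun block_index F n' -> 'I_n.+1}) : m \in mult_family F M n' ->
  exists2 x, x \in mpow_set F M n' & mults x = m.
Proof.
rewrite inE => /andP[/forallP mP /eqP m_n].
pose s' := flatten [seq nseq (m i) i | i <- enum (block_index F n')].
have s'E i : count_mem i s' = m i.
  rewrite count_flatten -map_comp (eq_map (_ : _ =1 fun j => (j == i) * m j)%N).
    rewrite sumnE big_map big_enum /= (bigD1 i) //= eqxx mul1n big1 ?addn0 //.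
    by move=> j /negPf->.
  by move=> j /=; rewrite count_nseq.
have s'V i : i \in s' -> valid i.
  rewrite -has_pred1 has_count s'E; have := mP i; case: (valid i) => // /eqP->.
  by [].
pose s := map (@block_of F n') s'.
have sE i : count_mem (block_of i) s = m i.
  rewrite count_map -s'E; apply: eq_count => j /=.
  by rewrite (inj_eq (@block_of_inj _ _)).
have s_prim : {in s, forall y, primary y}.
  move=> _ /mapP[i /s'V/andP[iX i_gt0] ->].
  by have [i_irr i_monic] := irrX_mi iX; split.
have s_X : {in s, forall y, y.1 != 'X}.
  by move=> _ /mapP[i /s'V/andP[iX _] ->]; apply: irrX_neq.
have s_size : bsize s = n.
  rewrite bsizeE big_map sum_count -[RHS]m_n; apply: eq_bigr => i _.
  by rewrite s'E.
pose A : 'M[F]_n := castmx (s_size, s_size) (bdiag s).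
have sA : mxsim A (bdiag s) := mxsim_cast s_size (bdiag s).
have UA : A \in unitmx.
  rewrite -row_free_unit /row_free (mxsim_rank sA) -[X in _ == X]s_size.
  by have := bdiag_unit s_prim s_X; rewrite -row_free_unit.
exists (FinRing.unit _ UA : GL).
  rewrite inE; apply/asboolP; apply: (mpow_sim sA); apply: mpow_bdiag => y.
  case/mapP=> i /s'V Vi ->; exists (m i); first by rewrite sE.
  have /andP[iX i_gt0] := Vi; apply: mpow_primary => //.
  by have := mP i; rewrite Vi.
apply/ffunP => i; rewrite ffunE; case: ifP => [Vi | nVi].
  have /andP[iX i_gt0] := Vi; rewrite (mult_bdiag sA) //; last exact: irrX_mi.
  by rewrite -[(_, _)]/(block_of i) sE inord_val.
by have := mP i; rewrite nVi => /eqP.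
Qed.

Lemma nb_power_classes_mult :
  nb_power_classes F n M = #|mult_family F M n'|.
Proof.
rewrite nb_power_classesE //.
rewrite (@card_imset_eq _ _ _ _ (@mults F n')); last first.
  by move=> x y _ _ /=; rewrite mults_eq.
congr #|pred_of_set _|; apply/setP => m.
apply/imsetP/idP => [[x xM ->] | /mults_surj[x xM <-]]; last by exists x.
exact: mults_mem.
Qed.

Lemma nb_power_classes_coef :
  (nb_power_classes F n M)%:R =
  (\prod_(1 <= k < n.+1) \prod_(f : {poly_n.+1 F} | irrX f)
     geomX (k * (deg f * mult_step M f))) n.
Proof.
rewrite nb_power_classes_mult -(@coef_prod_geomX _ (@valid F n') (@block_dim F n')
  (fun i => mult_step M i.1)); first last.
- by move=> i; rewrite /mult_step; case: ifP => // _; apply: prime_gt0.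
- by move=> i /andP[iX i_gt0]; rewrite muln_gt0 deg_irrX.
congr (coefs _ n).
rewrite big_geq_mkord exchange_big /= pair_big /=.
apply: eq_big => [i | i _]; first by rewrite /valid.
by rewrite /block_dim -mulnA mulnCA.
Qed.

End Count.

Theorem theorem8p7 (M q : nat) (F : finFieldType) (hM : prime M)
  (hq : #|F| = q) (hMq : coprime M q)
  (qM : {unit 'Z_M}) (hqM : val qM = q%:R) (t : nat) (ht : t = #[qM]%g) :
  let c (s m : nat) : fps := fps_substX m (cser s%:R) in
  let inner (j k : nat) : fps :=
    fps_rpow (c (q ^ t)%N (M ^ k * t * j)%N)
      ((1 - M%:R) ^+ 2 / (M ^ k.+1 * t)%:R) in
  let outer (j : nat) : fps :=
    c q j * fps_rpow (c (q ^ t)%N (t * j)%N) ((1 - M%:R) / (M * t)%:R)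
    * infprod (inner j) in
  [/\ forall j, (0 < j)%N -> infprod_cvg (inner j),
      infprod_cvg outer &
      power_classes_series F M = infprod outer].
Proof.
subst q; move=> c inner outer.
have otail j : (0 < j)%N -> eqm j.-1 (outer j) 1 by exact: (outer_tail F hM ht).
split.
- by move=> j j_gt0; eexists; apply: is_infprod_tail => k _; apply: (inner_tail F hM ht).
- by eexists; apply: is_infprod_tail.
apply: fpsP => -[|n].
  by rewrite (infprod_eqm otail (leqnn 0)) big_geq.
rewrite -[LHS]/((nb_power_classes F n.+1 M)%:R) (nb_power_classes_coef n hM hMq).
rewrite (infprod_eqm otail (leqnn n.+1)) !big_add1 /=.
apply: (eqm_prod (N := n.+1)) (leqnn _) => k _; apply: eqm_sym.
have H := @outer_factorE F M t qM hM hqM ht n.+1 n.+1 k.+1 (ltn0Sn k) (leqnn _).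
exact: H.
Qed.
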